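(* For all integers $n\ge 0$ with $n\ne 5$, \begin{align*} M^{*}(0,3,n)&>M^{*}(1,3,n)\quad\text{if } n\equiv 0 \text{ or } 2\pmod 3,\\ M^{*}(0,3,n)&<M^{*}(1,3,n)\quad\text{if } n\equiv 1\pmod 3. \end{align*}
   Context: Notation: $(a;q)_\infty:=\prod_{j=0}^{\infty}(1-aq^{j})$ and $(a_1,\dots,a_r;q)_\infty:=(a_1;q)_\infty\cdots(a_r;q)_\infty$. For integers $m$ and $n\ge 0$, the integer $M^{*}(m,n)$ is the (weighted) number of $2$-colored partitions of $n$ with Garvan bicrank equal to $m$; it is determined by the generating function $$\sum_{m=-\infty}^{\infty}\sum_{n=0}^{\infty}M^{*}(m,n)z^{m}q^{n}=\frac{(q;q)_{\infty}^{2}}{(zq,z^{-1}q,z^{2}q,z^{-2}q;q)_{\infty}},$$ where the right side is expanded as a formal power series in $q$ whose coefficients are Laurent polynomials in $z$ (this identity may be taken as the definition of $M^*(m,n)$). For integers $j$, $k\ge 1$, $n\ge 0$, set $$M^{*}(j,k,n):=\sum_{m\equiv j \,(\mathrm{mod}\ k)}M^{*}(m,n),$$ which is a finite sum. *)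

(* Defs.v *)
From HB Require Import structures.
From mathcomp Require Import all_boot all_order all_algebra finmap.
From mathcomp.multinomials Require Import monalg.

Set Implicit Arguments.
Unset Strict Implicit.
Unset Printing Implicit Defensive.

Import Order.TTheory GRing.Theory Num.Theory.
Local Open Scope ring_scope.

(* Laurent polynomials over int: finitely supported families of integers
   indexed by the exponent of z.  The ring structure that monalg puts on
   {malg int[K]} asks K to be a monoid without nontrivial units, which excludes
   K := int, so the convolution product is installed here. *)
Definition laurent : Type := {malg int[int]}.

HB.instance Definition _ := GRing.Zmodule.copy laurent {malg int[int]}.

Definition zpow (m : int) : laurent := << 1%R *g m >>.

Definition lmul (f g : laurent) : laurent :=
  \sum_(i <- msupp f) \sum_(j <- msupp g) << f@_i * g@_j *g (i + j)%R >>.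

Section LaurentRing.
Implicit Types f g h : laurent.

Local Open Scope fset_scope.

Lemma lmulEw (d1 d2 : {fset int}) f g :
  msupp f `<=` d1 -> msupp g `<=` d2 ->
  lmul f g = \sum_(i <- d1) \sum_(j <- d2) << f@_i * g@_j *g (i + j)%R >>.
Proof.
move=> le1 le2; rewrite /lmul (big_fset_incl _ le1) /=.
  apply: eq_bigr => i _; apply/big_fset_incl => // j _ /mcoeff_outdom ->.
  by rewrite mulr0 monalgU0.
move=> i _ /mcoeff_outdom fi.
by rewrite big1 // => j _; rewrite fi mul0r monalgU0.
Qed.

Lemma lmulC : commutative lmul.
Proof.
move=> f g; rewrite /lmul exchange_big /=; apply: eq_bigr => i _.
by apply: eq_bigr => j _; rewrite mulrC addrC.
Qed.

Lemma lmul0 g : lmul 0 g = 0.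
Proof. by rewrite /lmul msupp0 big_seq_fset0. Qed.

Lemma lmulDl : left_distributive lmul +%R.
Proof.
move=> f g h; rewrite [in RHS](lmulEw (fsubsetUl _ (msupp g)) (fsubset_refl _)).
rewrite [in RHS](lmulEw (fsubsetUr (msupp f) _) (fsubset_refl _)).
rewrite (lmulEw (msuppD_le _ _) (fsubset_refl _)).
rewrite -big_split /=; apply: eq_bigr => i _.
rewrite -big_split /=; apply: eq_bigr => j _.
by rewrite mcoeffD mulrDl monalgUD.
Qed.

Lemma lmulDr : right_distributive lmul +%R.
Proof. by move=> f g h; rewrite !(lmulC f) lmulDl. Qed.

Lemma lmulUU (a b : int) (i j : int) :
  lmul << a *g i >> << b *g j >> = << (a * b)%R *g (i + j)%R >>.
Proof. by rewrite (lmulEw msuppU_le msuppU_le) !big_seq_fset1 !mcoeffUU. Qed.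

Lemma lmul_suml I (r : seq I) (F : I -> laurent) g :
  lmul (\sum_(i <- r) F i) g = \sum_(i <- r) lmul (F i) g.
Proof. exact: (big_morph (lmul^~ g) (fun _ _ => lmulDl _ _ _) (lmul0 g)). Qed.

Lemma lmul_sumr I (r : seq I) (F : I -> laurent) g :
  lmul g (\sum_(i <- r) F i) = \sum_(i <- r) lmul g (F i).
Proof.
by rewrite lmulC lmul_suml; apply: eq_bigr => i _; exact: lmulC.
Qed.

Lemma lmulA : associative lmul.
Proof.
move=> f g h; rewrite [f]monalgE [g]monalgE [h]monalgE.
rewrite [LHS]lmul_suml [X in _ = lmul X _]lmul_suml [RHS]lmul_suml.
apply: eq_bigr => i _.
rewrite [X in lmul _ X]lmul_suml [LHS]lmul_sumr.
rewrite [X in _ = lmul X _]lmul_sumr [RHS]lmul_suml; apply: eq_bigr => j _.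
rewrite [X in lmul _ X]lmul_sumr [LHS]lmul_sumr [RHS]lmul_sumr; apply: eq_bigr => k _.
by rewrite !lmulUU mulrA addrA.
Qed.

Lemma lmul1 : left_id (zpow 0) lmul.
Proof.
move=> g; rewrite [RHS]monalgE {1}[g]monalgE lmul_sumr.
by apply: eq_bigr => i _; rewrite lmulUU mul1r add0r.
Qed.

Lemma zpow0_neq0 : zpow 0 != 0.
Proof. by rewrite /zpow monalgU_eq0 oner_eq0. Qed.

End LaurentRing.

HB.instance Definition _ := GRing.Zmodule_isComNzRing.Build laurent
  lmulA lmulC lmul1 lmulDl zpow0_neq0.

(* A formal power series in q is given by its sequence of coefficients; fps_mul is
   the Cauchy product. *)
Section PowerSeries.
Variable R : comNzRingType.

Definition fps : Type := nat -> R.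

Definition fps_one : fps := fun n => (n == 0%N)%:R.

Definition fps_mul (f g : fps) : fps :=
  fun n => \sum_(i < n.+1) f i * g (n - i)%N.

(* For f 0 = 1, the coefficients g 0, ..., g n of the inverse g of f, computed
   from g 0 = 1 and g n.+1 = - (f 1 * g n + ... + f n.+1 * g 0). *)
Fixpoint fps_inv_coefs (f : fps) (n : nat) : seq R :=
  if n is n'.+1 then
    let s := fps_inv_coefs f n' in
    rcons s (- \sum_(i < n) f i.+1 * s`_(n' - i))
  else [:: 1].

Definition fps_inv (f : fps) : fps := fun n => (fps_inv_coefs f n)`_n.

Lemma size_fps_inv_coefs f n : size (fps_inv_coefs f n) = n.+1.
Proof. by elim: n => //= n IHn; rewrite size_rcons IHn. Qed.

Lemma nth_fps_inv_coefs f n k :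
  (k <= n)%N -> (fps_inv_coefs f n)`_k = fps_inv f k.
Proof.
elim: n => [|n IHn]; first by case: k.
rewrite leq_eqVlt => /orP[/eqP -> //|lt_kn].
by rewrite /= nth_rcons size_fps_inv_coefs lt_kn IHn.
Qed.

Lemma fps_mulV f : f 0%N = 1 -> fps_mul f (fps_inv f) =1 fps_one.
Proof.
move=> f0 [|n]; first by rewrite /fps_mul big_ord1 f0 mul1r.
rewrite /fps_mul big_ord_recl f0 mul1r subn0 {1}/fps_inv /= nth_rcons.
rewrite size_fps_inv_coefs ltnn eqxx /fps_one /=.
apply/eqP; rewrite addrC subr_eq0; apply/eqP/eq_bigr => i _.
by rewrite /bump leq0n add1n subSS nth_fps_inv_coefs ?leq_subr.
Qed.

(* (a; q)_oo, with q represented by 'X.  The factors 1 - a q^j with j > n do not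
   contribute to the coefficient of q^n (see qpoch_stable), which is therefore
   that of a finite product. *)
Definition qpoch (a : {poly R}) : fps :=
  fun n => (\prod_(j < n.+1) (1 - a * 'X^j))`_n.

Lemma qpoch_stable (a : {poly R}) n N :
  (n < N)%N -> (\prod_(j < N) (1 - a * 'X^j))`_n = qpoch a n.
Proof.
move=> lt_nN; rewrite -(subnK lt_nN); elim: (N - n.+1)%N => [|d IHd] //.
rewrite addSn big_ord_recr /= mulrBr mulr1 coefB IHd mulrA coefMXn.
by rewrite addnS ltnS leq_addl subr0.
Qed.

(* (a_1, ..., a_r; q)_oo *)
Definition qpochs (s : seq {poly R}) : fps :=
  \big[fps_mul/fps_one]_(a <- s) qpoch a.

End PowerSeries.

(* z^m q as a polynomial in q. *)
Definition zq (m : int) : {poly laurent} := (zpow m)%:P * 'X.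

(* (q; q)_oo^2 / (z q, z^-1 q, z^2 q, z^-2 q; q)_oo *)
Definition bicrank_gf : fps laurent :=
  fps_mul (fps_mul (qpoch 'X) (qpoch 'X))
          (fps_inv (qpochs [:: zq 1; zq (-1); zq 2; zq (-2)])).

Definition Mstar (m : int) (n : nat) : int := (bicrank_gf n)@_m.

(* All m with Mstar m n != 0 lie in msupp (bicrank_gf n), so this is the sum
   over the whole residue class of j modulo k. *)
Definition Mstar_mod (j : int) (k n : nat) : int :=
  \sum_(m <- msupp (bicrank_gf n) | (m == j %[mod k])%Z) Mstar m n.

(* Main.v *)
From HB Require Import structures.
From mathcomp Require Import all_boot all_order all_algebra finmap.
From mathcomp.multinomials Require Import monalg.
From mathcomp Require Import boolp ring zify.
Require Import Defs.

(** Write (q) for the Euler product (q;q)_oo and let w be a primitive cube root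
    of unity.  At z = w the generating function of the M*(m,n) becomes

      G = (q)^4 / (q^3)^2,

    because (1 - w y)(1 - w^2 y) = (1 - y^3) / (1 - y).  Its coefficients are
    integers, and 1, w are independent over the integers; hence the residue
    classes 1 and 2 agree, and M*(0,3,n) - M*(1,3,n) is the coefficient of q^n
    in G (Mstar_mod_omega_gf).  The theorem is about the signs of these
    coefficients, one class of n modulo 3 at a time.

    Put Q = q^3 and let x, y, z be the theta functions
    (Q^a, Q^(9-a), Q^9; Q^9)_oo for a = 4, 2, 1.  Splitting Euler's pentagonal
    series by its index modulo 3 gives (q) = x - q y - q^2 z (atheta_dissect).
    The same is needed for (q)^3 / (q^3) = a(Q) - 3 q L1(Q), where a = 1 + 6 L,
    L = sum_n (sum_(d | n) chi(d)) q^n for the character chi modulo 3, and L1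
    collects the coefficients of L at the exponents 3 n + 1 (phi_cube).  So the
    classes of G are combinations of x, y, z with coefficients L and L1.  The
    same products occur in the dissection of (q) L, which is the derivative of
    the pentagonal series in a free variable; there they are the derivatives of
    x, y and z, and a theta function divides its derivative with a Lambert
    series as quotient.  Eliminating L1 leaves, with
    l_t = sum_n (#{d | n, d = t mod 9} - #{d | n, d = - t mod 9}) Q^n,

      class 0:    x / (Q) * (1 + 9 (l_1 - l_2)),
      class 1:  - y / (Q) * (4 + 9 (l_1 + l_4)),
      class 2:    z / (Q) * (2 + 9 (l_2 - l_4))

    (res0_G, res1_G, res2_G).  In every case a rapidly growing product
    with nonnegative coefficients multiplies a series of divisor sums.

    All series identities come from the Jacobi triple product (triple_product)
    and its logarithmic derivative in the free variable u (dtheta_product),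
    which is obtained by proving the product over dual numbers.  At u = 1 the
    derivative is Jacobi's formula for (q)^3, at u = w it expresses L, and in
    base Q^9 it handles x, y and z.

    For the signs, x / (Q) and y / (Q) have a factor 1 / (1 - Q), which replaces
    a series of divisor sums by the sums of psi(d) floor(n / d); these are
    nonnegative by Abel summation as soon as the partial sums of psi are.  In
    class 2 the factor is missing, but
    1 / ((1 - Q^2)(1 - Q^3)) = (1 - Q + Q^2) / ((1 - Q)(1 - Q^6)), and the
    polynomial costs a single divisor sum, which is outweighed (smoothed_ge).
    There the coefficient of Q vanishes, which is the exception n = 5. *)

Set Implicit Arguments.
Unset Strict Implicit.
Unset Printing Implicit Defensive.

Import Order.TTheory GRing.Theory Num.Theory.
Local Open Scope ring_scope.

(** * Formal power series *)

(** Equality of coefficient sequences is not decidable, so the ring structure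
    rests on classical equality and choice. *)
HB.instance Definition _ (R : comNzRingType) := gen_eqMixin (fps R).
HB.instance Definition _ (R : comNzRingType) := gen_choiceMixin (fps R).

Section FpsRing.
Variable R : comNzRingType.
Implicit Types f g h : fps R.

Definition fps_zero : fps R := fun _ => 0.
Definition fps_opp f : fps R := fun n => - f n.
Definition fps_add f g : fps R := fun n => f n + g n.

Fact fps_addA : associative fps_add.
Proof. by move=> f g h; apply/funext => n; exact: addrA. Qed.
Fact fps_addC : commutative fps_add.
Proof. by move=> f g; apply/funext => n; exact: addrC. Qed.
Fact fps_add0 : left_id fps_zero fps_add.
Proof. by move=> f; apply/funext => n; exact: add0r. Qed.
Fact fps_addN : left_inverse fps_zero fps_opp fps_add.
Proof. by move=> f; apply/funext => n; exact: addNr. Qed.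

HB.instance Definition _ :=
  GRing.isZmodule.Build (fps R) fps_addA fps_addC fps_add0 fps_addN.

Fact fps_mulC : commutative (@fps_mul R).
Proof.
move=> f g; apply/funext => n; rewrite /fps_mul (reindex_inj rev_ord_inj) /=.
by apply: eq_bigr => i _; rewrite subSS subKn ?leq_ord // mulrC.
Qed.

Fact fps_mul1 : left_id (@fps_one R) (@fps_mul R).
Proof.
move=> f; apply/funext => n; rewrite /fps_mul big_ord_recl /= mul1r subn0.
by rewrite big1 ?addr0 // => i _; rewrite mul0r.
Qed.

Fact fps_mulDl : left_distributive (@fps_mul R) +%R.
Proof.
move=> f g h; apply/funext => n; change (fps_mul (fps_add f g) h n =
  fps_mul f h n + fps_mul g h n).
by rewrite /fps_mul -big_split; apply: eq_bigr => i _; rewrite mulrDl.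
Qed.

Fact fps_mulA : associative (@fps_mul R).
Proof.
(* Both sides are the coefficient of a product of truncations, that is of
   polynomials. *)
move=> f g h; apply/funext => n; pose P u := \poly_(i < n.+1) (u : fps R) i.
have PM u v (r : nat) : (r <= n)%N -> (P u * P v)`_r = fps_mul u v r.
  move=> le_rn; rewrite coefM; apply: eq_bigr => i _.
  rewrite !coef_poly !ltnS (leq_trans (leq_ord i) le_rn).
  by rewrite (leq_trans (leq_subr i r) le_rn).
have PE u (r : nat) : (r <= n)%N -> (P u)`_r = u r.
  by move=> le_rn; rewrite coef_poly ltnS le_rn.
transitivity ((P f * P g * P h)`_n).
  rewrite -mulrA coefM; apply: eq_bigr => i _.
  by rewrite PE ?leq_ord // PM ?leq_subr.
by rewrite coefM; apply: eq_bigr => i _; rewrite PM ?leq_ord // PE ?leq_subr.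
Qed.

Fact fps_one_neq0 : (@fps_one R) != 0.
Proof.
by apply/eqP => /(congr1 (fun f : fps R => f 0%N)) /eqP; rewrite oner_eq0.
Qed.

HB.instance Definition _ := GRing.Zmodule_isComNzRing.Build (fps R)
  fps_mulA fps_mulC fps_mul1 fps_mulDl fps_one_neq0.

Lemma fpsP f g : (forall n, f n = g n) <-> f = g.
Proof. by split=> [/funext //|->]. Qed.

Lemma fps0E n : (0 : fps R) n = 0. Proof. by []. Qed.
Lemma fps1E n : (1 : fps R) n = (n == 0%N)%:R. Proof. by []. Qed.
Lemma fpsDE f g n : (f + g) n = f n + g n. Proof. by []. Qed.
Lemma fpsNE f n : (- f) n = - f n. Proof. by []. Qed.
Lemma fpsBE f g n : (f - g) n = f n - g n. Proof. by []. Qed.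
Lemma fpsME f g n : (f * g) n = \sum_(i < n.+1) f i * g (n - i)%N.
Proof. by []. Qed.
Lemma fps_mul0E f g : (f * g) 0%N = f 0%N * g 0%N.
Proof. by rewrite fpsME big_ord1. Qed.
Lemma fps_sumE I (r : seq I) (P : pred I) (F : I -> fps R) n :
  (\sum_(i <- r | P i) F i) n = \sum_(i <- r | P i) F i n.
Proof. by elim/big_rec2: _ => // i y f _ <-. Qed.
Lemma fpsMnE f k n : (f *+ k) n = f n *+ k.
Proof. by elim: k => // k IHk; rewrite !mulrS fpsDE IHk. Qed.

Definition mono (c : R) (m : nat) : fps R := fun n => (n == m)%:R * c.

Lemma monoE c m n : mono c m n = (n == m)%:R * c. Proof. by []. Qed.
Lemma mono1 : mono 1 0 = 1.
Proof. by apply/fpsP => n; rewrite monoE mulr1. Qed.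
Lemma mono0 m : mono 0 m = 0.
Proof. by apply/fpsP => n; rewrite monoE mulr0. Qed.
Lemma coef_monoM c m f n :
  (mono c m * f) n = if (m <= n)%N then c * f (n - m)%N else 0.
Proof.
rewrite fpsME; case: leqP => [le_mn|lt_nm].
  rewrite (bigD1 (Ordinal (le_mn : (m < n.+1)%N))) //= monoE eqxx mul1r.
  rewrite big1 ?addr0 // => i /negPf ne_im; rewrite monoE.
  by rewrite -[_ == m]/(i == Ordinal (le_mn : (m < n.+1)%N)) ne_im !mul0r.
rewrite big1 // => i _; rewrite monoE; case: eqP => [i_m|]; last by rewrite !mul0r.
by move: (leq_ord i); rewrite i_m leqNgt lt_nm.
Qed.
Lemma monoM c d m k : mono c m * mono d k = mono (c * d) (m + k).
Proof.
apply/fpsP => n; rewrite coef_monoM !monoE; case: leqP => [le_mn|lt_nm].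
  by rewrite mulrCA; congr (_%:R * _); rewrite -(eqn_add2l m) subnKC.
by rewrite ltn_eqF ?mul0r // ltn_addr.
Qed.
Lemma monoX c m k : mono c m ^+ k = mono (c ^+ k) (m * k).
Proof.
by elim: k => [|k IHk]; rewrite ?muln0 ?mono1 // !exprS IHk monoM mulnS.
Qed.
Lemma monoN c m : mono (- c) m = - mono c m.
Proof. by apply/fpsP => n; rewrite fpsNE !monoE mulrN. Qed.
Lemma monoD c d m : mono (c + d) m = mono c m + mono d m.
Proof. by apply/fpsP => n; rewrite fpsDE !monoE mulrDr. Qed.

(** Divisibility by q^N.  Convergence arguments are phrased as
    vanish N (f - g), a congruence modulo q^N. *)
Definition vanish (N : nat) f := forall n, (n < N)%N -> f n = 0.

Lemma vanishD N f g : vanish N f -> vanish N g -> vanish N (f + g).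
Proof. by move=> f0 g0 n n_lt; rewrite fpsDE f0 // g0 // addr0. Qed.
Lemma vanishN N f : vanish N f -> vanish N (- f).
Proof. by move=> f0 n n_lt; rewrite fpsNE f0 // oppr0. Qed.
Lemma vanishB N f g : vanish N f -> vanish N g -> vanish N (f - g).
Proof. by move=> f0 g0; apply/vanishD/vanishN. Qed.
Lemma vanishW N M f : (M <= N)%N -> vanish N f -> vanish M f.
Proof. by move=> le_MN f0 n n_lt; apply/f0/(leq_trans n_lt). Qed.
Lemma vanishM N M f g : vanish N f -> vanish M g -> vanish (N + M) (f * g).
Proof.
move=> f0 g0 n n_lt; rewrite fpsME big1 // => i _.
have [lt_iN|le_Ni] := ltnP i N; first by rewrite f0 ?mul0r.
by rewrite g0 ?mulr0 //; have := leq_ord i; lia.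
Qed.
Lemma vanishMl N f g : vanish N f -> vanish N (f * g).
Proof. by move=> f0; rewrite -[N]addn0; apply: vanishM. Qed.
Lemma vanishMr N f g : vanish N f -> vanish N (g * f).
Proof. by rewrite mulrC; exact: vanishMl. Qed.
Lemma vanishX N k f : vanish N f -> vanish (N * k) (f ^+ k).
Proof.
move=> f0; elim: k => [|k IHk]; first by rewrite muln0.
by rewrite exprS mulnS; apply: vanishM.
Qed.
Lemma vanish_sum N I (r : seq I) (P : pred I) (F : I -> fps R) :
  (forall i, P i -> vanish N (F i)) -> vanish N (\sum_(i <- r | P i) F i).
Proof. by move=> F0; apply: big_ind => //; exact: vanishD. Qed.
Lemma vanish_mono c m N : (N <= m)%N -> vanish N (mono c m).
Proof. by move=> le_Nm n lt_nN; rewrite monoE ltn_eqF ?mul0r ?(leq_trans lt_nN). Qed.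

Lemma eq_vanish f g : (forall N, vanish N (f - g)) -> f = g.
Proof.
move=> fg; apply/fpsP => n; apply/eqP; rewrite -subr_eq0.
by apply/eqP; exact: (fg n.+1 n).
Qed.

Lemma vanishM1 N f g : vanish N (f - 1) -> vanish N (g - 1) -> vanish N (f * g - 1).
Proof.
move=> f1 g1; have -> : f * g - 1 = (f - 1) * g + (g - 1) by ring.
by apply: vanishD => //; exact: vanishMl.
Qed.
Lemma vanish_prod1 N I (r : seq I) (P : pred I) (F : I -> fps R) :
  (forall i, P i -> vanish N (F i - 1)) ->
  vanish N (\prod_(i <- r | P i) F i - 1).
Proof.
move=> F1; apply: (big_ind (fun f => vanish N (f - 1))) => //.
  by rewrite subrr.
exact: vanishM1.
Qed.

(** ** Infinite sums and products *)

(** In degree n only the members of index at most n are used.  This is the true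
    limit for summable and multipliable families, whose i-th member has no effect
    below q^i. *)
Definition isum (F : nat -> fps R) : fps R := fun n => (\sum_(i < n.+1) F i) n.
Definition iprod (F : nat -> fps R) : fps R := fun n => (\prod_(i < n.+1) F i) n.

Definition summable (F : nat -> fps R) := forall i, vanish i (F i).
Definition multipliable (F : nat -> fps R) := forall i, vanish i (F i - 1).

Lemma isumP F N : summable F -> vanish N (isum F - \sum_(i < N) F i).
Proof.
move=> F0 n lt_nN; rewrite fpsBE /isum -(subnKC lt_nN) big_split_ord /=.
rewrite fpsDE opprD addrA subrr sub0r fps_sumE big1 ?oppr0 // => i _.
by apply: F0; rewrite addSn ltnS leq_addr.
Qed.

Lemma iprodP F N : multipliable F -> vanish N (iprod F - \prod_(i < N) F i).
Proof.
move=> F1 n lt_nN; rewrite fpsBE /iprod -(subnKC lt_nN) big_split_ord /=.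
set P := \prod_(i < n.+1) _; set S := \prod_(i < _) _.
have -> : P n - (P * S) n = - (P * (S - 1)) n.
  by rewrite mulrBr mulr1 fpsBE opprB.
rewrite -[X in - X](_ : 0 = _) ?oppr0 //; symmetry.
apply: (vanishMr (N := n.+1)) => //; apply: vanish_prod1 => i _.
by apply: vanishW (F1 _); rewrite leq_addr.
Qed.

Lemma isum_unique F f : summable F ->
  (forall N, vanish N (f - \sum_(i < N) F i)) -> f = isum F.
Proof.
move=> F0 fF; apply: eq_vanish => N.
have -> : f - isum F = (f - \sum_(i < N) F i) - (isum F - \sum_(i < N) F i) by ring.
by apply: vanishB => //; exact: isumP.
Qed.

Lemma iprod_unique F f : multipliable F ->
  (forall N, vanish N (f - \prod_(i < N) F i)) -> f = iprod F.
Proof.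
move=> F0 fF; apply: eq_vanish => N.
have -> : f - iprod F = (f - \prod_(i < N) F i) - (iprod F - \prod_(i < N) F i) by ring.
by apply: vanishB => //; exact: iprodP.
Qed.

Lemma eq_isum F G : F =1 G -> isum F = isum G.
Proof. by move=> FG; apply/fpsP => n; rewrite /isum; congr (_ n); apply: eq_bigr. Qed.
Lemma eq_iprod F G : F =1 G -> iprod F = iprod G.
Proof. by move=> FG; apply/fpsP => n; rewrite /iprod; congr (_ n); apply: eq_bigr. Qed.

Lemma isumD F G : isum (fun i => F i + G i) = isum F + isum G.
Proof. by apply/fpsP => n; rewrite /isum big_split. Qed.
Lemma isumN F : isum (fun i => - F i) = - isum F.
Proof. by apply/fpsP => n; rewrite /isum sumrN. Qed.
Lemma isumB F G : isum (fun i => F i - G i) = isum F - isum G.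
Proof. by rewrite isumD isumN. Qed.
Lemma isumMl f F : summable F -> isum (fun i => f * F i) = f * isum F.
Proof.
move=> F0; symmetry; apply: isum_unique => [i|N]; first exact: vanishMr.
by rewrite -mulr_sumr -mulrBr; apply/vanishMr/isumP.
Qed.

Lemma multipliableM F G : multipliable F -> multipliable G ->
  multipliable (fun i => F i * G i).
Proof. by move=> F1 G1 i; exact: vanishM1. Qed.

Lemma iprodM F G : multipliable F -> multipliable G ->
  iprod (fun i => F i * G i) = iprod F * iprod G.
Proof.
move=> F1 G1; symmetry; apply: iprod_unique => [|N]; first exact: multipliableM.
rewrite big_split /=; set P := \prod_(i < N) _; set S := \prod_(i < N) _.
have -> : iprod F * iprod G - P * S
  = (iprod F - P) * iprod G + P * (iprod G - S) by ring.
by apply: vanishD; [apply/vanishMl/iprodP | apply/vanishMr/iprodP].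
Qed.

Lemma multipliable_shift F : multipliable F -> multipliable (fun i => F i.+1).
Proof. by move=> F1 i; apply: vanishW (F1 _). Qed.

Lemma iprod_recl F : multipliable F -> iprod F = F 0%N * iprod (fun i => F i.+1).
Proof.
move=> F1; apply: eq_vanish => N.
have -> : iprod F - F 0%N * iprod (fun i => F i.+1) =
  (iprod F - \prod_(i < N.+1) F i) -
  F 0%N * (iprod (fun i => F i.+1) - \prod_(i < N) F i.+1).
  by rewrite big_ord_recl; ring.
apply: vanishB; first exact: (vanishW (leqnSn N) (iprodP F1)).
exact/vanishMr/iprodP/multipliable_shift.
Qed.

Lemma isum_recl F : summable F -> isum F = F 0%N + isum (fun i => F i.+1).
Proof.
move=> F0; apply: eq_vanish => N.
have -> : isum F - (F 0%N + isum (fun i => F i.+1)) =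
  (isum F - \sum_(i < N.+1) F i) - (isum (fun i => F i.+1) - \sum_(i < N) F i.+1).
  by rewrite big_ord_recl; ring.
apply: vanishB; first exact: (vanishW (leqnSn N) (isumP F0)).
by apply: isumP => i; exact: (vanishW (leqnSn i) (F0 i.+1)).
Qed.

(** Regrouping by m consecutive members separates the residues modulo m of the
    index. *)
Lemma big_ord_block (T : Type) (idx : T) (op : Monoid.law idx)
    (F : nat -> T) m N :
  \big[op/idx]_(i < m * N) F i =
  \big[op/idx]_(i < N) \big[op/idx]_(r < m) F (m * i + r)%N.
Proof.
elim: N => [|N IHN]; first by rewrite muln0 !big_ord0.
by rewrite mulnSr big_split_ord /= IHN big_ord_recr.
Qed.

Lemma multipliable_block F m : (0 < m)%N -> multipliable F ->
  multipliable (fun i => \prod_(r < m) F (m * i + r)%N).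
Proof.
move=> m_gt0 F1 i; apply: vanish_prod1 => r _; apply: vanishW (F1 _).
by rewrite (leq_trans (leq_pmull i m_gt0)) ?leq_addr.
Qed.

Lemma iprod_block F m : (0 < m)%N -> multipliable F ->
  iprod F = iprod (fun i => \prod_(r < m) F (m * i + r)%N).
Proof.
move=> m_gt0 F1; apply: iprod_unique => [|N]; first exact: multipliable_block.
rewrite -big_ord_block; exact: (vanishW (leq_pmull N m_gt0) (iprodP F1)).
Qed.

Lemma summable_block F m : (0 < m)%N -> summable F ->
  summable (fun i => \sum_(r < m) F (m * i + r)%N).
Proof.
move=> m_gt0 F1 i; apply: vanish_sum => r _; apply: vanishW (F1 _).
by rewrite (leq_trans (leq_pmull i m_gt0)) ?leq_addr.
Qed.

Lemma isum_block F m : (0 < m)%N -> summable F ->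
  isum F = isum (fun i => \sum_(r < m) F (m * i + r)%N).
Proof.
move=> m_gt0 F1; apply: isum_unique => [|N]; first exact: summable_block.
rewrite -big_ord_block; exact: (vanishW (leq_pmull N m_gt0) (isumP F1)).
Qed.

End FpsRing.

(** * Coefficientwise maps and dissection modulo 3 *)

Section FpsMap.
Variables (R S : comNzRingType) (h : {rmorphism R -> S}).

Definition fps_map (f : fps R) : fps S := fun n => h (f n).

Fact fps_map_zmod : zmod_morphism fps_map.
Proof. by move=> f g; apply/fpsP => n; rewrite /fps_map !fpsBE rmorphB. Qed.

Fact fps_map_monoid : monoid_morphism fps_map.
Proof.
split=> [|f g]; apply/fpsP => n; first by rewrite /fps_map !fps1E rmorph_nat.
rewrite /fps_map !fpsME rmorph_sum.
by apply: eq_bigr => i _; rewrite rmorphM.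
Qed.

HB.instance Definition _ :=
  GRing.isZmodMorphism.Build (fps R) (fps S) fps_map fps_map_zmod.
HB.instance Definition _ :=
  GRing.isMonoidMorphism.Build (fps R) (fps S) fps_map fps_map_monoid.

Lemma fps_mapE f n : fps_map f n = h (f n). Proof. by []. Qed.

Lemma fps_map_iprod F : fps_map (iprod F) = iprod (fun i => fps_map (F i)).
Proof. by apply/fpsP => n; rewrite /iprod -rmorph_prod. Qed.

Lemma fps_map_mono c m : fps_map (mono c m) = mono (h c) m.
Proof. by apply/fpsP => n; rewrite fps_mapE !monoE rmorphM rmorph_nat. Qed.

End FpsMap.

Section Dissection.
Variable R : comNzRingType.
Implicit Types f g : fps R.

(** sub3 f is f(q^3); a series f is the sum over r < 3 of q^r (res r f)(q^3). *)
Definition sub3 f : fps R := fun n => if (3 %| n)%N then f (n %/ 3)%N else 0.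
Definition res r f : fps R := fun n => f (3 * n + r)%N.

Lemma resD r f g : res r (f + g) = res r f + res r g. Proof. by []. Qed.
Lemma fps_resP f g :
  res 0 f = res 0 g -> res 1 f = res 1 g -> res 2 f = res 2 g -> f = g.
Proof.
move=> e0 e1 e2; apply/fpsP => n; rewrite (divn_eq n 3) mulnC.
have /fpsP e0' := e0; have /fpsP e1' := e1; have /fpsP e2' := e2.
have : (n %% 3 < 3)%N by rewrite ltn_mod.
case: (n %% 3)%N => [|[|[|//]]] _;
  [exact: e0' (n %/ 3)%N | exact: e1' (n %/ 3)%N | exact: e2' (n %/ 3)%N].
Qed.

Lemma res_sub3 r g : (r < 3)%N -> res r (sub3 g) = if r == 0%N then g else 0.
Proof.
move=> r_lt3; apply/fpsP => n; rewrite /res /sub3 dvdn_addr ?dvdn_mulr //.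
case: r r_lt3 => [|[|[|//]]] _ //=.
by rewrite addn0 mulKn.
Qed.

(** A Cauchy product with a series in q^3 only involves indices of one residue. *)
Lemma big_ord_res (h : nat -> R) r n : (r < 3)%N ->
  (forall i, (i <= 3 * n + r)%N -> (i %% 3 != r)%N -> h i = 0) ->
  \sum_(i < (3 * n + r).+1) h i = \sum_(j < n.+1) h (3 * j + r)%N.
Proof.
move=> r_lt3; elim: n => [|n IHn] h0.
  rewrite big_ord1 muln0 add0n big_ord_recr big1 /= ?add0r // => i _.
  apply: h0; first by rewrite muln0 add0n ltnW.
  by rewrite modn_small ?ltn_eqF // (ltn_trans _ r_lt3).
rewrite [RHS]big_ord_recr /= -IHn; last by move=> i le_i; apply: h0; lia.
have -> : (3 * n.+1 + r = (3 * n + r).+3)%N by lia.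
rewrite big_ord_recr /= big_ord_recr /= big_ord_recr /=.
rewrite (h0 (3 * n + r).+1) ?(h0 (3 * n + r).+2) ?addr0 //;
  by [lia | apply/eqP; lia].
Qed.

Lemma res_mulsub3 r f g : (r < 3)%N -> res r (f * sub3 g) = res r f * g.
Proof.
move=> r_lt3; apply/fpsP => n; rewrite [LHS]fpsME.
rewrite (@big_ord_res (fun i => f i * sub3 g (3 * n + r - i)%N)) //; last first.
  move=> i le_i i_r; rewrite /sub3; case: ifP => [/dvdnP[k dk]|].
    by case/eqP: i_r; move: dk le_i r_lt3; lia.
  by rewrite mulr0.
apply: eq_bigr => j _; rewrite /sub3 (_ : 3 * n + r - _ = 3 * (n - j))%N; last lia.
by rewrite dvdn_mulr // mulKn.
Qed.

Lemma res_sub3mul r f g : (r < 3)%N -> res r (sub3 g * f) = g * res r f.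
Proof. by move=> r_lt3; rewrite mulrC res_mulsub3 // mulrC. Qed.

Fact sub3_zmod : zmod_morphism sub3.
Proof.
by move=> f g; apply/fpsP => n; rewrite fpsBE /sub3; case: ifP; rewrite ?subr0.
Qed.

Fact sub3_monoid : monoid_morphism sub3.
Proof.
split=> [|f g].
  apply/fpsP => n; rewrite /sub3 !fps1E; case: ifP => [/dvdnP[k ->]|].
    by rewrite mulnK // muln_eq0 orbF.
  by case: n.
by apply: fps_resP; rewrite res_mulsub3 // !res_sub3 ?mul0r.
Qed.

HB.instance Definition _ :=
  GRing.isZmodMorphism.Build (fps R) (fps R) sub3 sub3_zmod.
HB.instance Definition _ :=
  GRing.isMonoidMorphism.Build (fps R) (fps R) sub3 sub3_monoid.

Lemma sub3_mono c m : sub3 (mono c m) = mono c (3 * m).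
Proof.
apply/fpsP => n; rewrite /sub3 !monoE; case: ifP => [/dvdnP[k ->]|n3].
  by rewrite mulnK // mulnC eqn_pmul2l.
by case: eqP n3 => [->|_ _]; rewrite ?mul0r ?dvdn_mulr.
Qed.

Lemma sub3_vanish N f : vanish N f -> vanish N (sub3 f).
Proof.
move=> f0 n lt_nN; rewrite /sub3; case: ifP => // _.
by apply: f0; apply: leq_ltn_trans (leq_div n 3) lt_nN.
Qed.

Lemma sub3_isum F : summable F -> sub3 (isum F) = isum (fun i => sub3 (F i)).
Proof.
move=> F0; apply: isum_unique => [i|N]; first exact/sub3_vanish/F0.
by rewrite -rmorph_sum -rmorphB; apply/sub3_vanish/isumP.
Qed.

Lemma sub3_iprod F : multipliable F -> sub3 (iprod F) = iprod (fun i => sub3 (F i)).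
Proof.
move=> F1; apply: iprod_unique => [i|N].
  by rewrite -(rmorph1 sub3) -rmorphB; apply/sub3_vanish/F1.
by rewrite -rmorph_prod -rmorphB; apply/sub3_vanish/iprodP.
Qed.

Lemma sub3_inj : injective sub3.
Proof. by move=> f g /(congr1 (res 0)); rewrite !res_sub3. Qed.

Lemma res_mono1 r f : (r < 3)%N ->
  res r (mono 1 1 * sub3 f) = if r == 1%N then f else 0.
Proof.
move=> r_lt3; rewrite res_mulsub3 //; case: r r_lt3 => [|[|[|//]]] _ /=.
- rewrite (_ : res 0 _ = 0) ?mul0r //; apply/fpsP => n.
  by rewrite /res monoE; case: eqP; rewrite ?mul0r //; lia.
- rewrite (_ : res 1 _ = 1) ?mul1r //; apply/fpsP => n.
  rewrite /res monoE mulr1 fps1E.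
  by congr (nat_of_bool _)%:R; apply/eqP/eqP; lia.
- rewrite (_ : res 2 _ = 0) ?mul0r //; apply/fpsP => n.
  by rewrite /res monoE; case: eqP; rewrite ?mul0r //; lia.
Qed.

Lemma res_mono2 r f : (r < 3)%N ->
  res r (mono 1 2 * sub3 f) = if r == 2%N then f else 0.
Proof.
move=> r_lt3; rewrite res_mulsub3 //; case: r r_lt3 => [|[|[|//]]] _ /=.
- rewrite (_ : res 0 _ = 0) ?mul0r //; apply/fpsP => n.
  by rewrite /res monoE; case: eqP; rewrite ?mul0r //; lia.
- rewrite (_ : res 1 _ = 0) ?mul0r //; apply/fpsP => n.
  by rewrite /res monoE; case: eqP; rewrite ?mul0r //; lia.
- rewrite (_ : res 2 _ = 1) ?mul1r //; apply/fpsP => n.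
  rewrite /res monoE mulr1 fps1E.
  by congr (nat_of_bool _)%:R; apply/eqP/eqP; lia.
Qed.

End Dissection.

(** * Quadratic extensions: dual numbers and Eisenstein integers *)

(** K[T] / (T^2 - u T - v), where (a, b) stands for a + b T.  Two cases serve: the
    dual numbers (u = v = 0), which turn an identity with a free variable into its
    derivative, and the Eisenstein integers (u = v = -1). *)
Definition quad (K : comNzRingType) (u v : K) : Type := (K * K)%type.

Section Quad.
Variables (K : comNzRingType) (u v : K).
HB.instance Definition _ := GRing.Zmodule.copy (quad u v) (K * K)%type.

Implicit Types x y z : quad u v.

Definition quad_one : quad u v := (1, 0).
Definition quad_mul x y : quad u v :=
  (x.1 * y.1 + v * (x.2 * y.2), x.1 * y.2 + x.2 * y.1 + u * (x.2 * y.2)).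

Fact quad_mulA : associative quad_mul.
Proof. by move=> x y z; rewrite /quad_mul /=; congr (_, _); ring. Qed.
Fact quad_mulC : commutative quad_mul.
Proof. by move=> x y; rewrite /quad_mul; congr (_, _); ring. Qed.
Fact quad_mul1 : left_id quad_one quad_mul.
Proof. by move=> [a b]; rewrite /quad_mul /=; congr (_, _); ring. Qed.
Fact quad_mulDl : left_distributive quad_mul +%R.
Proof. by move=> [a b] [c d] [e f]; rewrite /quad_mul /=; congr (_, _) => /=; ring. Qed.
Fact quad_one_neq0 : quad_one != 0.
Proof. by apply/eqP => /(congr1 fst) /eqP; rewrite oner_eq0. Qed.

HB.instance Definition _ := GRing.Zmodule_isComNzRing.Build (quad u v)
  quad_mulA quad_mulC quad_mul1 quad_mulDl quad_one_neq0.

Lemma quadME x y : x * y =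
  (x.1 * y.1 + v * (x.2 * y.2), x.1 * y.2 + x.2 * y.1 + u * (x.2 * y.2)).
Proof. by []. Qed.

Definition quad_in (a : K) : quad u v := (a, 0).
Fact quad_in_zmod : zmod_morphism quad_in.
Proof. by move=> a b; congr (_, _); rewrite /= subr0. Qed.
Fact quad_in_monoid : monoid_morphism quad_in.
Proof.
by split=> // a b; rewrite quadME /=; congr (_, _); rewrite !(mul0r, mulr0, addr0).
Qed.
HB.instance Definition _ :=
  GRing.isZmodMorphism.Build K (quad u v) quad_in quad_in_zmod.
HB.instance Definition _ :=
  GRing.isMonoidMorphism.Build K (quad u v) quad_in quad_in_monoid.

Definition pr1 (f : fps (quad u v)) : fps K := fun n => (f n).1.
Definition pr2 (f : fps (quad u v)) : fps K := fun n => (f n).2.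

Fact pr1_zmod : zmod_morphism pr1. Proof. by []. Qed.
Fact pr2_zmod : zmod_morphism pr2. Proof. by []. Qed.
HB.instance Definition _ :=
  GRing.isZmodMorphism.Build (fps (quad u v)) (fps K) pr1 pr1_zmod.
HB.instance Definition _ :=
  GRing.isZmodMorphism.Build (fps (quad u v)) (fps K) pr2 pr2_zmod.

Lemma quad_sum1 I (r : seq I) (P : pred I) (F : I -> quad u v) :
  (\sum_(i <- r | P i) F i).1 = \sum_(i <- r | P i) (F i).1.
Proof. by elim/big_rec2: _ => // i y1 y2 _ <-. Qed.
Lemma quad_sum2 I (r : seq I) (P : pred I) (F : I -> quad u v) :
  (\sum_(i <- r | P i) F i).2 = \sum_(i <- r | P i) (F i).2.
Proof. by elim/big_rec2: _ => // i y1 y2 _ <-. Qed.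

Lemma pr1M f g : pr1 (f * g) = pr1 f * pr1 g + mono v 0 * (pr2 f * pr2 g).
Proof.
apply/fpsP => n; rewrite fpsDE coef_monoM /= subn0 /pr1 !fpsME quad_sum1.
by rewrite mulr_sumr -big_split /=.
Qed.
Lemma pr2M f g :
  pr2 (f * g) = pr1 f * pr2 g + pr2 f * pr1 g + mono u 0 * (pr2 f * pr2 g).
Proof.
apply/fpsP => n; rewrite !fpsDE coef_monoM /= subn0 /pr2 !fpsME quad_sum2.
by rewrite mulr_sumr -!big_split /=.
Qed.

Lemma pr1D f g : pr1 (f + g) = pr1 f + pr1 g. Proof. by []. Qed.
Lemma pr2D f g : pr2 (f + g) = pr2 f + pr2 g. Proof. by []. Qed.

Lemma pr1_isum F : pr1 (isum F) = isum (fun i => pr1 (F i)).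
Proof. by apply/fpsP => n; rewrite /isum -raddf_sum. Qed.
Lemma pr2_isum F : pr2 (isum F) = isum (fun i => pr2 (F i)).
Proof. by apply/fpsP => n; rewrite /isum -raddf_sum. Qed.

Lemma pr1_mono c m : pr1 (mono c m) = mono c.1 m.
Proof. by apply/fpsP => n; rewrite /pr1 !monoE; case: eqP; rewrite ?mul1r ?mul0r. Qed.
Lemma pr2_mono c m : pr2 (mono c m) = mono c.2 m.
Proof. by apply/fpsP => n; rewrite /pr2 !monoE; case: eqP; rewrite ?mul1r ?mul0r. Qed.
Lemma pr1_1 : pr1 1 = 1.
Proof. by rewrite -mono1 pr1_mono mono1. Qed.
Lemma pr2_1 : pr2 1 = 0.
Proof. by rewrite -mono1 pr2_mono; apply/fpsP => n; rewrite monoE mulr0. Qed.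
Lemma pr1_map (f : fps K) : pr1 (fps_map quad_in f) = f.
Proof. by []. Qed.
Lemma pr2_map (f : fps K) : pr2 (fps_map quad_in f) = 0.
Proof. by []. Qed.
Lemma vanish_pr1 N f : vanish N f -> vanish N (pr1 f).
Proof. by move=> f0 n lt_nN; rewrite /pr1 f0. Qed.
Lemma vanish_pr2 N f : vanish N f -> vanish N (pr2 f).
Proof. by move=> f0 n lt_nN; rewrite /pr2 f0. Qed.

End Quad.

(** ** Dual numbers *)

Definition dual (K : comNzRingType) : comNzRingType := quad (0 : K) 0.

Section Dual.
Variable K : comNzRingType.
Implicit Types f g : fps (dual K).

Lemma dual_pr1M f g : pr1 (f * g) = pr1 f * pr1 g.
Proof. by rewrite pr1M mono0 mul0r addr0. Qed.
Lemma dual_pr2M f g : pr2 (f * g) = pr1 f * pr2 g + pr2 f * pr1 g.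
Proof. by rewrite pr2M mono0 mul0r addr0. Qed.

Lemma dual_pr1_prod I (r : seq I) (P : pred I) (F : I -> fps (dual K)) :
  pr1 (\prod_(i <- r | P i) F i) = \prod_(i <- r | P i) pr1 (F i).
Proof. exact: (big_morph _ dual_pr1M (pr1_1 _ _)). Qed.

Lemma dual_pr1_iprod (F : nat -> fps (dual K)) :
  pr1 (iprod F) = iprod (fun i => pr1 (F i)).
Proof. by apply/fpsP => n; rewrite /iprod -dual_pr1_prod. Qed.

(** The product rule in logarithmic form: pr2 is a derivation over pr1. *)
Lemma dual_pr2_iprod (F : nat -> fps (dual K)) (G : nat -> fps K) :
  multipliable F -> (forall i, pr1 (F i) * G i = 1) ->
  pr2 (iprod F) = iprod (fun i => pr1 (F i)) * isum (fun i => pr2 (F i) * G i).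
Proof.
move=> F1 FG; have F2 i : vanish i (pr2 (F i)).
  have <- : pr2 (F i - 1) = pr2 (F i) by rewrite raddfB /= pr2_1 subr0.
  exact/vanish_pr2/F1.
have fin N : pr2 (\prod_(i < N) F i) =
    \prod_(i < N) pr1 (F i) * \sum_(i < N) pr2 (F i) * G i.
  elim: N => [|N IHN]; first by rewrite !big_ord0 pr2_1 mulr0.
  rewrite !big_ord_recr /= dual_pr2M IHN dual_pr1_prod.
  set P := \prod_(i < N) _; set S := \sum_(i < N) _.
  rewrite -[P * pr2 (F N)]mulr1 -(FG N); ring.
apply: eq_vanish => N; set S := isum _.
have -> : pr2 (iprod F) - iprod (fun i => pr1 (F i)) * S =
    pr2 (iprod F - \prod_(i < N) F i)
  - (pr1 (iprod F - \prod_(i < N) F i) * S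
     + \prod_(i < N) pr1 (F i) * (S - \sum_(i < N) pr2 (F i) * G i)).
  by rewrite !raddfB /= fin dual_pr1_iprod dual_pr1_prod; ring.
apply: vanishB; first exact/vanish_pr2/iprodP.
apply: vanishD; first exact/vanishMl/vanish_pr1/iprodP.
by apply/vanishMr/isumP => i; apply/vanishMl.
Qed.

End Dual.

(** * The Jacobi triple product *)

Lemma sum_ord_recl (V : nmodType) (F : nat -> V) n :
  \sum_(i < n.+1) F i = F 0%N + \sum_(i < n) F i.+1.
Proof. exact: big_ord_recl. Qed.

Section FiniteTripleProduct.
Variables (R : comNzRingType) (s t : R).
Let p := s * t.

(** Gaussian binomial coefficient in base p *)
Fixpoint gbinom (N j : nat) : R :=
  match N, j with
  | _, 0 => 1
  | 0, _.+1 => 0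
  | N'.+1, j'.+1 => gbinom N' j'.+1 + p ^+ (N' - j') * gbinom N' j'
  end.

Lemma gbinom0 N : gbinom N 0 = 1. Proof. by case: N. Qed.
Lemma gbinomS N j :
  gbinom N.+1 j.+1 = gbinom N j.+1 + p ^+ (N - j) * gbinom N j.
Proof. by []. Qed.
Lemma gbinom_small N j : (N < j)%N -> gbinom N j = 0.
Proof.
elim: N j => [|N IHN] [|j] //= lt_Nj.
by rewrite !IHN ?mulr0 ?addr0 // ltnW.
Qed.

(** The mirror image of the defining recurrence; the two together give the
    quotient formula gbinom_fact without any division. *)
Lemma gbinomS' N j :
  gbinom N.+1 j.+1 = gbinom N j + p ^+ j.+1 * gbinom N j.+1.
Proof.
elim: N j => [|N IHN] j; first by case: j => [|j] /=; rewrite ?mulr0 ?add0r ?addr0 ?mulr1.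
have [lt_Nj|le_jN] := ltnP N.+1 j.
  by rewrite !gbinom_small ?mulr0 ?addr0 //; lia.
rewrite gbinomS [in LHS]IHN.
case: j le_jN => [_|j le_jN].
  rewrite gbinomS !gbinom0 !subn0 !mulr1 expr1 exprS; ring.
rewrite [gbinom N.+1 j.+2]gbinomS {1}(IHN j) [gbinom N.+1 j.+1]gbinomS.
rewrite subSS; case: (ltnP j N) => [lt_jN|le_Nj].
  have -> : (N - j = (N - j.+1).+1)%N by lia.
  by rewrite !exprS; ring.
rewrite (gbinom_small (_ : N < j.+1)%N) // (gbinom_small (_ : N < j.+2)%N) //; last by lia.
ring.
Qed.

Lemma gbinom_rec N j :
  (1 - p ^+ j.+1) * gbinom N j.+1 = (1 - p ^+ (N - j)) * gbinom N j.
Proof.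
have := gbinomS' N j; rewrite gbinomS => e.
have -> : (1 - p ^+ j.+1) * gbinom N j.+1 =
  gbinom N j.+1 + p ^+ (N - j) * gbinom N j
  - p ^+ (N - j) * gbinom N j - p ^+ j.+1 * gbinom N j.+1 by ring.
by rewrite e; ring.
Qed.

Lemma gbinom_fact N j : (j <= N)%N ->
  gbinom N j * \prod_(i < j) (1 - p ^+ i.+1) = \prod_(i < j) (1 - p ^+ (N - i)).
Proof.
elim: j => [|j IHj] le_jN; first by rewrite !big_ord0 gbinom0 mulr1.
rewrite !big_ord_recr /= -IHj ?(ltnW le_jN) //.
have := gbinom_rec N j; set P := \prod_(i < j) _ => e.
transitivity (P * ((1 - p ^+ j.+1) * gbinom N j.+1)); first by ring.
by rewrite e; ring.
Qed.

(** The summand (-1)^k s^k p^(k (k-1) / 2) of the two-sided series at k = j - n.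
    For k < 0 it is written with t, which plays the role of p / s, so that s need
    not be invertible. *)
Definition finite_term (n j : nat) : R :=
  if (n <= j)%N then (- s) ^+ (j - n) * p ^+ 'C(j - n, 2)
  else (- t) ^+ (n - j) * p ^+ 'C(n - j, 2).

Lemma finite_term_s n j m : (j <= n + m)%N ->
  s * p ^+ m * finite_term n j = - (p ^+ (n + m - j) * finite_term n j.+1).
Proof.
rewrite /finite_term => le_j; case: (leqP n j) => [le_nj|lt_jn].
  rewrite (leqW le_nj) subSn // binS bin1 exprD exprS.
  have -> : (m = (n + m - j) + (j - n))%N by lia.
  have -> : (n + (n + m - j + (j - n)) - j = n + m - j)%N by lia.
  rewrite exprD; ring.
case: (leqP n j.+1) => [le_nj|lt_j1n].
  have -> : (n = j.+1)%N by lia.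
  rewrite subSnn subnn /= !expr0 expr1 mulr1.
  have -> : (j.+1 + m - j = m.+1)%N by lia.
  by rewrite exprS /p; ring.
have [k ->] : exists k, (n = j + k.+2)%N by exists (n - j.+2)%N; lia.
rewrite (_ : j + k.+2 - j = k.+2)%N; last lia.
rewrite (_ : j + k.+2 - j.+1 = k.+1)%N; last lia.
rewrite (_ : j + k.+2 + m - j = k.+2 + m)%N; last lia.
by rewrite binS bin1 !exprD exprS [p ^+ k.+2]exprS /p; ring.
Qed.

Lemma finite_term_t n j : (j <= n)%N ->
  t * p ^+ n * finite_term n j = - (p ^+ j * finite_term n.+1 j).
Proof.
rewrite /finite_term => le_jn; rewrite [(n < j)%N]ltnNge le_jn /=.
have -> : (if (n <= j)%N then (- s) ^+ (j - n) * p ^+ 'C(j - n, 2)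
    else (- t) ^+ (n - j) * p ^+ 'C(n - j, 2)) =
    (- t) ^+ (n - j) * p ^+ 'C(n - j, 2).
  case: leqP => // le_nj; have -> : (n = j)%N by lia.
  by rewrite subnn.
rewrite subSn // binS bin1 exprD exprS -{1}(subnKC le_jn) exprD; ring.
Qed.

Lemma finite_termS n j : finite_term n.+1 j.+1 = finite_term n j.
Proof. by rewrite /finite_term ltnS !subSS. Qed.

Lemma prod_t n :
  \prod_(i < n) (1 - t * p ^+ i) = \sum_(j < n.+1) finite_term n j * gbinom n j.
Proof.
elim: n => [|n IHn].
  by rewrite big_ord0 big_ord1 /finite_term /= mulr1 mulr1.
rewrite big_ord_recr /= IHn mulrBr mulr1 mulr_suml.
have -> : \sum_(j < n.+1) finite_term n j * gbinom n j * (t * p ^+ n) =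
    - \sum_(j < n.+1) p ^+ j * finite_term n.+1 j * gbinom n j.
  rewrite -sumrN; apply: eq_bigr => j _.
  by rewrite mulrC mulrA finite_term_t ?leq_ord // mulNr.
rewrite opprK [RHS](sum_ord_recl (fun j => finite_term n.+1 j * gbinom n.+1 j)).
under [in RHS]eq_bigr => j _ do rewrite gbinomS' finite_termS mulrDr.
rewrite big_split /= addrCA; congr (_ + _).
rewrite [LHS](sum_ord_recl (fun j => p ^+ j * finite_term n.+1 j * gbinom n j)).
rewrite mul1r !gbinom0; congr (_ + _).
rewrite [RHS]big_ord_recr /= gbinom_small // !mulr0 addr0.
by apply: eq_bigr => j _; rewrite -finite_termS; ring.
Qed.

(** Cauchy's finite form of the triple product.  A new factor moves every summand
    to a neighbouring index, and the weights recombine by the Pascal rule. *)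
Lemma finite_triple_product n m :
  \prod_(i < n) (1 - t * p ^+ i) * \prod_(i < m) (1 - s * p ^+ i) =
  \sum_(j < (n + m).+1) finite_term n j * gbinom (n + m) j.
Proof.
elim: m => [|m IHm]; first by rewrite big_ord0 mulr1 addn0 prod_t.
rewrite big_ord_recr /= mulrA IHm addnS mulrBr mulr1 mulr_suml.
have -> : \sum_(j < (n + m).+1) finite_term n j * gbinom (n + m) j * (s * p ^+ m) =
    - \sum_(j < (n + m).+1) finite_term n j.+1 * (p ^+ (n + m - j) * gbinom (n + m) j).
  rewrite -sumrN; apply: eq_bigr => j _.
  by rewrite mulrC [LHS]mulrA finite_term_s ?leq_ord //; ring.
rewrite opprK [RHS](sum_ord_recl (fun j => finite_term n j * gbinom (n + m).+1 j)).
under [in RHS]eq_bigr => j _ do rewrite gbinomS mulrDr.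
rewrite big_split /= addrA; congr (_ + _).
rewrite [LHS](sum_ord_recl (fun j => finite_term n j * gbinom (n + m) j)).
by rewrite [in RHS]big_ord_recr /= !gbinom0 gbinom_small // mulr0 addr0.
Qed.

End FiniteTripleProduct.

Section TripleProduct.
Variables (R : comNzRingType) (s t : fps R).
Hypothesis t0 : vanish 1 t.
Let p := s * t.
Let p0 : vanish 1 p. Proof. exact: vanishMr. Qed.

Let pX k : vanish k (p ^+ k).
Proof. by rewrite -{1}[k]mul1n; apply: vanishX. Qed.

Definition euler_factor i : fps R := 1 - p ^+ i.+1.

Let euler_mul : multipliable euler_factor.
Proof.
move=> i; rewrite /euler_factor addrAC subrr sub0r; apply: vanishN.
exact: (vanishW (leqnSn i) (@pX i.+1)).
Qed.

(** The indices - k and k + 1 of the two-sided series are taken together. *)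
Definition triple_term k : fps R :=
  (- t) ^+ k * p ^+ 'C(k, 2) + (- s) ^+ k.+1 * p ^+ 'C(k.+1, 2).

Lemma triple_summable : summable triple_term.
Proof.
move=> k; apply: vanishD.
  by apply: vanishMl; rewrite -{1}[k]mul1n; apply/vanishX/vanishN.
apply: vanishMr; apply: vanishW (@pX _).
by rewrite binS bin1 leq_addl.
Qed.

Definition triple_factor i : fps R :=
  (1 - s * p ^+ i.+1) * (1 - t * p ^+ i) * (1 - p ^+ i.+1).

Let t_mul : multipliable (fun i => 1 - t * p ^+ i).
Proof.
move=> i; rewrite addrAC subrr sub0r; apply: vanishN.
exact: vanishMr.
Qed.
Let s_mul : multipliable (fun i => 1 - s * p ^+ i.+1).
Proof.
move=> i; rewrite addrAC subrr sub0r; apply: vanishN.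
apply: vanishMr; exact: (vanishW (leqnSn i) (@pX i.+1)).
Qed.

Lemma triple_multipliable : multipliable triple_factor.
Proof. exact: multipliableM (multipliableM s_mul t_mul) euler_mul. Qed.

(** Far from both ends a Gaussian binomial is close to 1 / (p;p)_oo. *)
Let gbinom_euler N j : (j <= N)%N ->
  vanish (minn j (N - j)).+1 (gbinom s t N j * iprod euler_factor - 1).
Proof.
move=> le_jN; set P := \prod_(i < j) euler_factor i.
have eP : gbinom s t N j * P = \prod_(i < j) (1 - p ^+ (N - i)).
  exact: gbinom_fact.
have -> : gbinom s t N j * iprod euler_factor - 1 =
  gbinom s t N j * (iprod euler_factor - \prod_(i < j.+1) euler_factor i)
  - gbinom s t N j * P * p ^+ j.+1
  + (\prod_(i < j) (1 - p ^+ (N - i)) - 1).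
  by rewrite -eP big_ord_recr /= -/P -[euler_factor j]/(1 - p ^+ j.+1); ring.
apply: vanishD; last first.
  apply: vanish_prod1 => i _; rewrite addrAC subrr sub0r; apply: vanishN.
  by apply: vanishW (@pX _); have := ltn_ord i; lia.
apply: vanishB; last by apply: vanishMr; apply: vanishW (@pX _); lia.
by apply: vanishMr; apply: vanishW (iprodP euler_mul); lia.
Qed.

(** The finite form with N and N + 1 factors is multiplied by (p;p)_oo.  Then the
    weight of each summand is close to 1, or the summand itself is divisible by a
    high power of q.  The factor 1 - s stays outside the infinite product because s
    may be a constant, and then 1 - s need not be a unit. *)
Theorem triple_product : (1 - s) * iprod triple_factor = isum triple_term.
Proof.
apply: isum_unique triple_summable _ => N.
pose E := iprod euler_factor.
have fin := finite_triple_product s t N N.+1; rewrite -/p in fin.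
have -> : (1 - s) * iprod triple_factor - \sum_(i < N) triple_term i =
   (1 - s) * (iprod triple_factor
      - \prod_(i < N) ((1 - s * p ^+ i.+1) * (1 - t * p ^+ i)) * E)
   + \sum_(j < (N + N.+1).+1) finite_term s t N j * (gbinom s t (N + N.+1) j * E - 1)
   + (\sum_(j < (N + N.+1).+1) finite_term s t N j - \sum_(i < N) triple_term i).
  under [\sum_(j < _) _ * (_ - 1)]eq_bigr => j _ do rewrite mulrBr mulr1 mulrA.
  rewrite sumrB -mulr_suml -fin [\prod_(i < N.+1) _]big_ord_recl /= expr0 mulr1.
  by rewrite [\prod_(i < N) (_ * _)]big_split /=; under [\prod_(i < N) (1 - s * p ^+ bump 0 i)]eq_bigr do
    rewrite /bump leq0n add1n; ring.
apply: vanishD; first apply: vanishD.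
- apply: vanishMr.
  rewrite [iprod triple_factor](iprodM (multipliableM s_mul t_mul) euler_mul) -mulrBl.
  by apply/vanishMl/iprodP/multipliableM.
- apply: vanish_sum => j _; have le_j := ltn_ord j; rewrite ltnS in le_j.
  have := gbinom_euler le_j; rewrite /finite_term; case: leqP => [le_Nj|lt_jN] gE.
    apply: (@vanishW _ (('C(j - N, 2)) + (minn j (N + N.+1 - j)).+1)).
      have : (j - N <= ('C(j - N, 2)).+1)%N.
        by case: (j - N)%N => // k; rewrite binS bin1 ltnS leq_addl.
      lia.
    by apply: vanishM => //; apply/vanishMr/pX.
  apply: (@vanishW _ ((N - j) + (minn j (N + N.+1 - j)).+1)); first by lia.
  apply: vanishM => //; apply/vanishMl.
  by rewrite -{1}[(N - j)%N]mul1n; apply/vanishX/vanishN.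
have -> : \sum_(j < (N + N.+1).+1) finite_term s t N j = \sum_(k < N.+1) triple_term k.
  rewrite /triple_term big_split /= -addSn big_split_ord /=; congr (_ + _).
    rewrite (reindex_inj rev_ord_inj) /=; apply: eq_bigr => k _.
    rewrite subSS /finite_term; case: k => k /= lt_k.
    case: leqP => [le_Nk|]; last by rewrite subKn.
    by rewrite (_ : k = 0)%N ?subn0 ?subnn //; lia.
  apply: eq_bigr => k _; rewrite /finite_term ifT; last by lia.
  by rewrite (_ : N.+1 + k - N = k.+1)%N //; lia.
by rewrite big_ord_recr /= addrAC subrr add0r; apply: triple_summable.
Qed.

End TripleProduct.

(** ** The triple product and its derivative in a free variable *)

Section Geometric.
Variable K : comNzRingType.

(** 1 / (1 - c q^m) *)
Definition geo (c : K) m : fps K :=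
  fun n => if (m %| n)%N then c ^+ (n %/ m) else 0.

Lemma geoM c m : (0 < m)%N -> (1 - mono c m) * geo c m = 1.
Proof.
move=> m_gt0; apply/fpsP => n; rewrite mulrBl mul1r fpsBE coef_monoM fps1E /geo.
case: leqP => [le_mn|lt_nm]; last first.
  rewrite subr0; case: n lt_nm => [_|n lt_nm]; first by rewrite dvdn0 div0n.
  by rewrite gtnNdvd.
rewrite (gtn_eqF (leq_trans m_gt0 le_mn)) (dvdn_subl le_mn (dvdnn m)).
case: ifP => [/dvdnP[k def_n]|_]; last by rewrite mulr0 subrr.
move: le_mn; rewrite def_n; case: k {def_n} => [|k _]; first by rewrite leqNgt m_gt0.
by rewrite mulnK // mulSn addKn mulnK // -exprS subrr.
Qed.

Lemma mono_geoE c m n : (0 < m)%N ->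
  (mono c m * geo c m) n = if (m %| n)%N && (0 < n)%N then c ^+ (n %/ m) else 0.
Proof.
move=> m_gt0; have -> : mono c m * geo c m = geo c m - 1.
  by rewrite -(geoM c m_gt0); ring.
rewrite fpsBE fps1E /geo; case: n => [|n] /=; last by rewrite subr0 andbT.
by rewrite dvdn0 div0n subrr andbF.
Qed.

End Geometric.

Section ThetaDerivative.
Variables (K : comNzRingType) (u v : K) (a c : nat).
Hypotheses (uv : u * v = 1) (c_gt0 : (0 < c)%N).

(** The exponents in the series of the (-1)^k u^k q^(a k + (a + c) k (k-1) / 2)
    over all integers k, at the indices - k and k + 1; v is the inverse of u. *)
Definition expA k := (c * k + (a + c) * 'C(k, 2))%N.
Definition expB k := (a * k.+1 + (a + c) * 'C(k.+1, 2))%N.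

Definition theta : fps K := isum (fun k =>
  mono ((-1) ^+ k * v ^+ k) (expA k) +
  mono ((-1) ^+ k.+1 * u ^+ k.+1) (expB k)).

(** The image of theta under the derivation u d/du *)
Definition dtheta : fps K := isum (fun k =>
  mono ((-1) ^+ k.+1 * (v ^+ k *+ k)) (expA k) +
  mono ((-1) ^+ k.+1 * (u ^+ k.+1 *+ k.+1)) (expB k)).

Definition theta_factor i : fps K :=
  (1 - mono u (a + (a + c) * i.+1)) * (1 - mono v (c + (a + c) * i)) *
  (1 - mono 1 ((a + c) * i.+1)).

(* u is replaced by u (1 + eps). *)
Let S : fps (dual K) := mono ((u, u) : dual K) a.
Let T : fps (dual K) := mono ((v, - v) : dual K) c.

Let uvd : ((u, u) : dual K) * ((v, - v) : dual K) = 1.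
Proof.
by rewrite quadME /= uv; congr (_, _); rewrite ?mul0r ?addr0 // mulrN uv addNr.
Qed.

Let uX k : ((u, u) : dual K) ^+ k = (u ^+ k, u ^+ k *+ k).
Proof.
elim: k => // k IHk; rewrite exprS IHk quadME /=; congr (_, _).
  by rewrite !mul0r addr0 exprS.
by rewrite mul0r addr0 exprS mulrnAr mulrS addrC.
Qed.

Let vX k : ((v, - v) : dual K) ^+ k = (v ^+ k, - (v ^+ k *+ k)).
Proof.
elim: k => [|k IHk]; first by rewrite mulr0n oppr0.
rewrite exprS IHk quadME /=; congr (_, _).
  by rewrite !mul0r addr0 exprS.
by rewrite mul0r addr0 exprS mulrN mulrnAr mulNr mulrS opprD addrC.
Qed.

Let ST : S * T = mono 1 (a + c).
Proof. by rewrite /S /T monoM uvd. Qed.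

Let T0 : vanish 1 T. Proof. exact: vanish_mono. Qed.

Let STX i : (S * T) ^+ i = mono 1 ((a + c) * i).
Proof. by rewrite ST monoX expr1n. Qed.

Let triple_termE k : triple_term S T k =
  mono ((-1) ^+ k * ((v ^+ k, - (v ^+ k *+ k)) : dual K)) (expA k) +
  mono ((-1) ^+ k.+1 * ((u ^+ k.+1, u ^+ k.+1 *+ k.+1) : dual K)) (expB k).
Proof.
rewrite /triple_term !STX /S /T -!monoN !monoX !monoM !mulr1.
by rewrite (exprNn ((v, - v) : dual K)) (exprNn ((u, u) : dual K)) uX vX.
Qed.

Let triple_factorE i : triple_factor S T i =
  (1 - mono ((u, u) : dual K) (a + (a + c) * i.+1)) *
  (1 - mono ((v, - v) : dual K) (c + (a + c) * i)) *
  (1 - mono 1 ((a + c) * i.+1)).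
Proof. by rewrite /triple_factor !STX /S /T !monoM !mulr1. Qed.

Let pr1_factor i : pr1 (triple_factor S T i) = theta_factor i.
Proof.
rewrite triple_factorE !dual_pr1M !raddfB /= !pr1_1 !pr1_mono //.
Qed.

Let sg1 k (x : dual K) : ((-1) ^+ k * x).1 = (-1) ^+ k * x.1.
Proof. by rewrite -signr_odd -[in RHS]signr_odd; case: odd; rewrite ?mul1r ?mulN1r. Qed.
Let sg2 k (x : dual K) : ((-1) ^+ k * x).2 = (-1) ^+ k * x.2.
Proof. by rewrite -signr_odd -[in RHS]signr_odd; case: odd; rewrite ?mul1r ?mulN1r. Qed.

Lemma theta_product : theta = (1 - mono u a) * iprod theta_factor.
Proof.
have := congr1 (@pr1 _ _ _) (triple_product S T0).
rewrite dual_pr1M dual_pr1_iprod (eq_iprod pr1_factor) raddfB /= pr1_1 pr1_mono.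
move=> ->; rewrite pr1_isum; apply: eq_isum => k.
by rewrite triple_termE raddfD /= !pr1_mono !sg1.
Qed.

(** The part along eps of the triple product at u (1 + eps): the factor 1 - u q^a
    contributes - u q^a, the others their logarithmic derivatives. *)
Lemma dtheta_product : dtheta = iprod theta_factor * (- mono u a + (1 - mono u a) *
  isum (fun i =>
    mono v (c + (a + c) * i) * geo v (c + (a + c) * i)
    - mono u (a + (a + c) * i.+1) * geo u (a + (a + c) * i.+1))).
Proof.
have := congr1 (@pr2 _ _ _) (triple_product S T0).
pose g i := geo u (a + (a + c) * i.+1) * geo v (c + (a + c) * i) *
            geo 1 ((a + c) * i.+1).
have ac_gt0 : (0 < a + c)%N by rewrite addn_gt0 c_gt0 orbT.
have gu i : (1 - mono u (a + (a + c) * i.+1)) * geo u (a + (a + c) * i.+1) = 1.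
  by apply: geoM; rewrite addn_gt0 muln_gt0 ac_gt0 orbT.
have gv i : (1 - mono v (c + (a + c) * i)) * geo v (c + (a + c) * i) = 1.
  by apply: geoM; rewrite addn_gt0 c_gt0.
have g1 i : (1 - mono 1 ((a + c) * i.+1)) * geo (1 : K) ((a + c) * i.+1) = 1.
  by apply: geoM; rewrite muln_gt0 ac_gt0.
have Fg i : pr1 (triple_factor S T i) * g i = 1.
  rewrite pr1_factor /theta_factor /g.
  have := congr2 *%R (congr2 *%R (gu i) (gv i)) (g1 i); rewrite !mulr1 => e.
  rewrite -[RHS]e.
  ring.
rewrite dual_pr2M (dual_pr2_iprod (triple_multipliable S T0) Fg).
rewrite dual_pr1_iprod (eq_iprod pr1_factor) !raddfB /=.
rewrite pr1_1 pr2_1 pr1_mono pr2_mono sub0r /=.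
have -> : pr2 (isum (triple_term S T)) = dtheta.
  rewrite pr2_isum; apply: eq_isum => k.
  rewrite triple_termE raddfD /= !pr2_mono !sg2 /=; congr (mono _ _ + _).
  by rewrite exprS mulN1r mulNr mulrN.
move=> <-; rewrite [RHS]mulrDr addrC mulrC; congr (_ + _).
rewrite mulrCA; congr (_ * (_ * _)); apply: eq_isum => i.
rewrite triple_factorE !dual_pr2M !dual_pr1M !raddfB /= !pr1_1 !pr2_1.
rewrite !pr1_mono !pr2_mono /= monoN.
rewrite mono0.
have eu := gu i; have ev := gv i; have e1 := g1 i.
rewrite !sub0r oppr0 mulr0 add0r opprK /g.
set U := mono u _ in eu *; set V := mono v _ in ev *.
set W := mono 1 _ in e1 *.
transitivity (V * geo v (c + (a + c) * i) * ((1 - U) * geo u (a + (a + c) * i.+1))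
   * ((1 - W) * geo 1 ((a + c) * i.+1))
   - U * geo u (a + (a + c) * i.+1) * ((1 - V) * geo v (c + (a + c) * i))
   * ((1 - W) * geo 1 ((a + c) * i.+1))); first by ring.
by rewrite eu ev e1 !mulr1.
Qed.

End ThetaDerivative.

(** * Divisor sums *)

Definition divsum (p : nat -> int) : fps int :=
  fun n => \sum_(d < n) (d.+1 %| n)%:R * p d.+1.

Lemma divsum0 p : divsum p 0 = 0. Proof. by rewrite /divsum big_ord0. Qed.

Lemma divsumE p n N : (0 < n)%N -> (n <= N)%N ->
  divsum p n = \sum_(d < N) (d.+1 %| n)%:R * p d.+1.
Proof.
move=> n_gt0 le_nN; rewrite -(subnKC le_nN) big_split_ord /= [X in _ + X]big1.
  by rewrite addr0.
by move=> d _; rewrite gtnNdvd ?mul0r // ltnS leq_addr.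
Qed.

Lemma sum_divisors (F : nat -> int) n : (0 < n)%N ->
  \sum_(d < n) (d.+1 %| n)%:R * F d.+1 = \sum_(d <- divisors n) F d.
Proof.
move=> n_gt0; rewrite [RHS](perm_big [seq d <- iota 1 n | (d %| n)%N]) /=; last first.
  apply: uniq_perm; rewrite ?divisors_uniq ?filter_uniq ?iota_uniq // => d.
  rewrite -dvdn_divisors // mem_filter mem_iota add1n ltnS.
  by case dn: (d %| n)%N => //=; rewrite (dvdn_gt0 n_gt0 dn) (dvdn_leq n_gt0 dn).
rewrite big_filter -[1%N]addn0 iotaDl big_map [RHS]big_mkcond /=.
rewrite -[n in iota 0 n]subn0 -/(index_iota 0 n) big_mkord.
by apply: eq_bigr => i _; rewrite add1n; case: ifP; rewrite ?mul1r ?mul0r.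
Qed.

Lemma sum_divisors_swap (F : nat -> int) n : (0 < n)%N ->
  \sum_(d <- divisors n) F d = \sum_(d <- divisors n) F (n %/ d)%N.
Proof.
move=> n_gt0; rewrite -(big_map (fun d => n %/ d)%N predT F); apply: perm_big.
have divK d : (d %| n)%N -> (n %/ (n %/ d) = d)%N.
  by move=> dn; rewrite divnA // mulKn.
rewrite perm_sym; apply: uniq_perm; rewrite ?divisors_uniq //.
  rewrite map_inj_in_uniq ?divisors_uniq // => d e.
  by rewrite -!dvdn_divisors // => /divK {2}<- /divK {2}<- ->.
move=> d; apply/mapP/idP => [[e] |].
  by rewrite -!dvdn_divisors // => en ->; rewrite -{2}(divnK en) dvdn_mulr.
rewrite -dvdn_divisors // => dn; exists (n %/ d)%N; last by rewrite divK.
by rewrite -dvdn_divisors // -{2}(divnK dn) dvdn_mulr.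
Qed.

Lemma divsum_swap p n :
  divsum p n = \sum_(d < n) (d.+1 %| n)%:R * p (n %/ d.+1)%N.
Proof.
case: n => [|n]; first by rewrite divsum0 big_ord0.
rewrite /divsum sum_divisors // (@sum_divisors (fun d => p (n.+1 %/ d)%N)) //.
exact: sum_divisors_swap.
Qed.

Lemma eq_divsum p p' : p =1 p' -> divsum p = divsum p'.
Proof. by move=> e; apply/fpsP => n; apply: eq_bigr => d _; rewrite e. Qed.

(** The nontrivial Dirichlet character modulo 3 *)
Definition chi3 d : int := (d %% 3 == 1)%N%:R - (d %% 3 == 2)%N%:R.

(** A divisor of 3 n that is prime to 3 divides n. *)
Lemma res0_divsum_chi3 : res 0 (divsum chi3) = divsum chi3.
Proof.
apply/fpsP => -[|n]; rewrite /res ?muln0 // addn0.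
rewrite (@divsumE _ (3 * n.+1) (3 * n.+1)) // (@divsumE _ n.+1 (3 * n.+1)) //; last by lia.
apply: eq_bigr => i _; have [i3|i3] := boolP (3 %| i.+1)%N.
  by rewrite /chi3 (eqP i3) subrr !mulr0.
by rewrite Gauss_dvdr // coprime_sym prime_coprime.
Qed.

(** If n = 2 modulo 3, then d and n / d have opposite characters. *)
Lemma res2_divsum_chi3 : res 2 (divsum chi3) = 0.
Proof.
apply/fpsP => n; rewrite fps0E /res; set m := (3 * n + 2)%N.
suff: divsum chi3 m = - divsum chi3 m by move=> e; lia.
rewrite [in LHS]divsum_swap /divsum -sumrN; apply: eq_bigr => d' _.
set d := d'.+1; case: dvdnP => [[k mk]|_]; last by rewrite !mul0r oppr0.
rewrite !mul1r /chi3; have d_gt0 : (0 < d)%N by [].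
rewrite mk mulnK //; have : (k * d %% 3 = 2)%N by rewrite -mk /m; lia.
rewrite -modnMm; have := ltn_pmod k (isT : (0 < 3)%N).
have := ltn_pmod d (isT : (0 < 3)%N).
by case: (d %% 3)%N => [|[|[|//]]]; case: (k %% 3)%N => [|[|[|//]]].
Qed.

Lemma divsum_chi3_dissect :
  divsum chi3 = sub3 (divsum chi3) + mono 1 1 * sub3 (res 1 (divsum chi3)).
Proof.
by apply: fps_resP; rewrite resD res_sub3 // res_mono1 //= ?addr0 ?add0r
  ?res0_divsum_chi3 ?res2_divsum_chi3.
Qed.

(** * Identities of Euler and Jacobi *)

Lemma euler_multipliable (K : comNzRingType) m : (0 < m)%N ->
  multipliable (fun i => 1 - mono (1 : K) (m * i.+1)).
Proof.
move=> m_gt0 i; rewrite addrAC subrr sub0r; apply/vanishN/vanish_mono.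
by rewrite (leq_trans (leqnSn i)) // leq_pmull.
Qed.

Definition phi : fps int := iprod (fun i => 1 - mono 1 i.+1).

Lemma phi_multipliable : multipliable (fun i => 1 - mono (1 : int) i.+1).
Proof. by move=> i; have := @euler_multipliable int 1 isT i; rewrite mul1n. Qed.

Lemma sub3_phi : sub3 phi = iprod (fun i => 1 - mono 1 (3 * i.+1)).
Proof.
rewrite sub3_iprod; last exact: phi_multipliable.
by apply: eq_iprod => i; rewrite rmorphB rmorph1 /= sub3_mono.
Qed.

Lemma bin2S n : 'C(n.+1, 2) = (n + 'C(n, 2))%N.
Proof. by rewrite binS bin1 addnC. Qed.

Lemma bin2_3 n : 'C(3 * n, 2) = (9 * 'C(n, 2) + 3 * n)%N.
Proof.
elim: n => // n IHn; rewrite (_ : 3 * n.+1 = (3 * n).+3)%N; last by lia.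
by rewrite !bin2S IHn; lia.
Qed.

Lemma monoMn (K : comNzRingType) (c : K) m k : mono c m *+ k = mono (c *+ k) m.
Proof. by elim: k => [|k IHk]; rewrite ?mono0 // !mulrS IHk monoD. Qed.

Lemma mono_summable (K : comNzRingType) (c : nat -> K) (e : nat -> nat) :
  (forall k, (k <= e k)%N) -> summable (fun k => mono (c k) (e k)).
Proof. by move=> le_ke k; apply: vanish_mono. Qed.

Definition jacobi_term (k : nat) : fps int :=
  mono ((-1) ^+ k * (2 * k + 1)%:R) 'C(k.+1, 2).

Lemma jacobi_summable : summable jacobi_term.
Proof. by apply: mono_summable => k; rewrite bin2S leq_addr. Qed.

Lemma expAE01 k : expA 0 1 k = 'C(k.+1, 2).
Proof. by rewrite /expA bin2S; lia. Qed.
Lemma expBE01 k : expB 0 1 k = 'C(k.+1, 2).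
Proof. by rewrite /expB; lia. Qed.

(** The derivative of the triple product at u = 1: there 1 - u vanishes, so the
    derivative is the remaining product. *)
Theorem jacobi_cube : phi ^+ 3 = isum jacobi_term.
Proof.
have := @dtheta_product int 1 1 0 1 (mulr1 1) isT.
rewrite mono1 subrr mul0r addr0 mulrN1.
have -> : iprod (theta_factor 1 1 0 1) = phi ^+ 3.
  have m1 := phi_multipliable; have m2 := multipliableM m1 m1.
  rewrite !exprS expr0 mulr1 mulrA /phi -!iprodM //.
  by apply: eq_iprod => i; rewrite /theta_factor !add0n !mul1n add1n.
move/(congr1 -%R); rewrite opprK => <-; rewrite /dtheta -isumN.
apply: eq_isum => k; rewrite expAE01 expBE01 -monoD -monoN; congr mono.
rewrite !expr1n -mulrDr -mulrnDr exprS; have -> : (2 * k + 1 = k + k.+1)%N by lia.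
by rewrite mulN1r mulNr opprK.
Qed.

(** At u = v = 1, atheta is theta and datheta is - dtheta. *)
Section AlternatingSeries.
Variables a c : nat.

Definition atheta_term (k : nat) : fps int :=
  mono ((-1) ^+ k) (expA a c k) - mono ((-1) ^+ k) (expB a c k).

Definition datheta_term (k : nat) : fps int :=
  mono ((-1) ^+ k * k%:R) (expA a c k) + mono ((-1) ^+ k * k.+1%:R) (expB a c k).

Definition atheta : fps int := isum atheta_term.
Definition datheta : fps int := isum datheta_term.

End AlternatingSeries.

Lemma leq_expA a c k : (0 < c)%N -> (k <= expA a c k)%N.
Proof. by move=> c_gt0; rewrite /expA (leq_trans (leq_pmull k c_gt0)) ?leq_addr. Qed.

Lemma leq_expB a c k : (0 < c)%N -> (k <= expB a c k)%N.
Proof. by move=> c_gt0; rewrite /expB bin2S mulnDr; nia. Qed.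

Lemma atheta_summable a c : (0 < c)%N -> summable (atheta_term a c).
Proof.
by move=> c0 k; apply: vanishB; apply: vanish_mono; [apply: leq_expA | apply: leq_expB].
Qed.

Lemma datheta_summable a c : (0 < c)%N -> summable (datheta_term a c).
Proof.
by move=> c0 k; apply: vanishD; apply: vanish_mono; [apply: leq_expA | apply: leq_expB].
Qed.

Lemma binE0 j : 'C((3 * j).+1, 2) = (3 * expA 1 2 j)%N.
Proof. by rewrite bin2S bin2_3 /expA; lia. Qed.
Lemma binE1 j : 'C((3 * j + 1).+1, 2) = (1 + 3 * (3 * 'C(j.+1, 2)))%N.
Proof. by rewrite addn1 !bin2S bin2_3; lia. Qed.
Lemma binE2 j : 'C((3 * j + 2).+1, 2) = (3 * expB 1 2 j)%N.
Proof. by rewrite addn2 !bin2S bin2_3 /expB bin2S; lia. Qed.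

Lemma sum3 (V : nmodType) (F : nat -> V) :
  \sum_(r < 3) F r = F 0%N + F 1%N + F 2%N.
Proof. by rewrite !big_ord_recr big_ord0 /= add0r. Qed.

Lemma sign3 (K : comNzRingType) j r : (-1 : K) ^+ (3 * j + r) = (-1) ^+ j * (-1) ^+ r.
Proof. by rewrite exprD exprM; congr (_ ^+ j * _); rewrite !exprS expr0; ring. Qed.

Local Notation eis := (quad (-1 : int) (-1)).

(** omega is T itself, a root of T^2 + T + 1. *)
Definition omega : eis := (0, 1).
Definition omega2 : eis := (-1, -1).

Lemma omegaE : omega * omega = omega2. Proof. by []. Qed.
Lemma omega3 : omega * omega2 = 1. Proof. by []. Qed.
Lemma omegaX j : omega ^+ (3 * j) = 1.
Proof. by rewrite exprM (_ : omega ^+ 3 = 1) ?expr1n. Qed.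
Lemma omega2X j : omega2 ^+ (3 * j) = 1.
Proof. by rewrite exprM (_ : omega2 ^+ 3 = 1) ?expr1n. Qed.

Lemma omega_chi3 j : omega2 ^+ j - omega ^+ j = (omega2 - omega) * quad_in _ _ (chi3 j).
Proof.
rewrite {1 2}(divn_eq j 3) mulnC (exprD omega2 (3 * (j %/ 3))).
rewrite (exprD omega (3 * (j %/ 3))) omegaX omega2X !mul1r /chi3.
have := ltn_pmod j (isT : (0 < 3)%N).
by case: (j %% 3)%N => [|[|[|//]]] _; apply/eqP.
Qed.

Lemma eis_nat (x : eis) k : x *+ k = (x.1 *+ k, x.2 *+ k).
Proof. by elim: k => // k IHk; rewrite !mulrS IHk. Qed.
Lemma eis_sign1 (x : eis) k : ((-1) ^+ k * x).1 = (-1) ^+ k * x.1.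
Proof. by rewrite -signr_odd -[in RHS]signr_odd; case: odd; rewrite ?mul1r ?mulN1r. Qed.
Lemma eis_sign2 (x : eis) k : ((-1) ^+ k * x).2 = (-1) ^+ k * x.2.
Proof. by rewrite -signr_odd -[in RHS]signr_odd; case: odd; rewrite ?mul1r ?mulN1r. Qed.

Lemma eis_factor m : (1 - mono omega m) * (1 - mono omega2 m) * (1 - mono 1 m) =
  1 - mono 1 (3 * m) :> fps eis.
Proof.
have mE c : mono c m = mono c 0 * mono 1 m :> fps eis by rewrite monoM mulr1.
have -> : mono 1 (3 * m) = mono 1 m ^+ 3 :> fps eis.
  by rewrite monoX expr1n mulnC.
rewrite (mE omega) (mE omega2) -[omega2]omegaE -(addn0 0%N) -monoM.
have w0 : mono omega 0 * mono omega 0 = - 1 - mono omega 0 :> fps eis.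
  by rewrite monoM -mono1 -!monoN -monoD.
rewrite w0; set y := mono 1 m; set w := mono omega 0 in w0 *.
have -> : (1 - w * y) * (1 - (- 1 - w) * y) * (1 - y) =
  1 - y ^+ 3 - (w * w + w + 1) * (y ^+ 2 * (1 - y)) by ring.
by rewrite w0; ring.
Qed.

Lemma eis_euler :
  iprod (theta_factor omega omega2 0 1) = fps_map (quad_in (-1) (-1)) (sub3 phi).
Proof.
rewrite sub3_phi fps_map_iprod; apply: eq_iprod => i.
by rewrite rmorphB rmorph1 /= fps_map_mono rmorph1 /theta_factor !add0n !mul1n add1n eis_factor.
Qed.

(** The difference of the geometric series of omega^2 q^m and omega q^m marks the
    multiples j m by omega^(2 j) - omega^j, a constant times chi3 j. *)
Lemma eis_lambert :
  isum (fun i => mono omega2 (1 + (0 + 1) * i) * geo omega2 (1 + (0 + 1) * i)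
    - mono omega (0 + (0 + 1) * i.+1) * geo omega (0 + (0 + 1) * i.+1)) =
  mono (omega2 - omega) 0 * fps_map (quad_in (-1) (-1)) (divsum chi3).
Proof.
apply/fpsP => n; rewrite /isum fps_sumE coef_monoM leq0n subn0 fps_mapE.
case: n => [|n].
  by rewrite divsum0 rmorph0 mulr0 big_ord1 fpsBE !mono_geoE // andbF subrr.
rewrite divsum_swap rmorph_sum mulr_sumr big_ord_recr /= fpsBE !mono_geoE //.
rewrite !add0n !mul1n !add1n !gtnNdvd //= subrr addr0; apply: eq_bigr => i _.
rewrite fpsBE !mono_geoE // !add0n !mul1n !add1n andbT.
case: ifP => _; last by rewrite mul0r rmorph0 mulr0 subrr.
by rewrite mul1r omega_chi3.
Qed.

Definition eis_coef k : eis :=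
  (-1) ^+ k.+1 * (omega2 ^+ k *+ k + omega ^+ k.+1 *+ k.+1).

Lemma eis_dtheta : dtheta omega omega2 0 1 = isum (fun k =>
  mono (eis_coef k) 'C(k.+1, 2)).
Proof.
apply: eq_isum => k; rewrite expAE01 expBE01 -monoD; congr mono.
by rewrite /eis_coef mulrDr.
Qed.

Lemma eis_coef0 j : eis_coef (3 * j) =
  ((-1) ^+ j * - (3 * j)%:R, (-1) ^+ j * - (3 * j).+1%:R).
Proof.
have := sign3 eis j 1; rewrite addn1 /eis_coef => ->.
rewrite omega2X (exprS omega) omegaX mulr1 expr1 -mulrA !eis_nat.
rewrite [LHS]surjective_pairing eis_sign1 eis_sign2 mulN1r; congr (_ * _, _ * _) => /=.
  by rewrite mul0rn addr0.
by rewrite mul0rn add0r.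
Qed.

Lemma eis_coef1 j : eis_coef (3 * j + 1) =
  ((-1) ^+ j * - (6 * j + 3)%:R, (-1) ^+ j * - (6 * j + 3)%:R).
Proof.
have := sign3 eis j 2; rewrite /eis_coef -addnS => ->.
rewrite !(exprD _ (3 * j)%N) omega2X omegaX !mul1r expr1.
rewrite sqrrN expr1n mulr1 -mulrnDr (_ : 3 * j + 1 + _ = 6 * j + 3)%N; last lia.
by rewrite eis_nat [LHS]surjective_pairing eis_sign1 eis_sign2 /= !mulNrn.
Qed.

Lemma eis_coef2 j : eis_coef (3 * j + 2) =
  ((-1) ^+ j * - (3 * j + 3)%:R, (-1) ^+ j * - (3 * j + 2)%:R).
Proof.
have := sign3 eis j 3; rewrite /eis_coef -addnS => ->.
rewrite !(exprD _ (3 * j)%N) omega2X omegaX !mul1r.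
rewrite (_ : omega2 ^+ 2 = omega) // (_ : omega ^+ 3 = 1) // (_ : (-1) ^+ 3 = - 1 :> eis) //.
rewrite -mulrA mulN1r !eis_nat [LHS]surjective_pairing eis_sign1 eis_sign2 /=.
by rewrite !mul0rn add0r addr0.
Qed.

Lemma sub3_dpentagonal : sub3 (datheta 1 2) = isum (fun j =>
  mono ((-1) ^+ j * j%:R) (3 * expA 1 2 j) + mono ((-1) ^+ j * j.+1%:R) (3 * expB 1 2 j)).
Proof.
rewrite (sub3_isum (datheta_summable 1 (isT : (0 < 2)%N))); apply: eq_isum => j.
by rewrite rmorphD /= !sub3_mono.
Qed.

Lemma sub3_pentagonal : sub3 (atheta 1 2) = isum (fun j =>
  mono ((-1) ^+ j) (3 * expA 1 2 j) - mono ((-1) ^+ j) (3 * expB 1 2 j)).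
Proof.
rewrite (sub3_isum (atheta_summable 1 (isT : (0 < 2)%N))); apply: eq_isum => j.
by rewrite rmorphB /= !sub3_mono.
Qed.

Lemma sub3_jacobi : mono 1 1 * sub3 (sub3 (isum jacobi_term)) = isum (fun j =>
  mono ((-1) ^+ j * (2 * j + 1)%:R) (1 + 3 * (3 * 'C(j.+1, 2)))).
Proof.
rewrite (sub3_isum jacobi_summable) sub3_isum; last first.
  by move=> k; apply/sub3_vanish/jacobi_summable.
rewrite -isumMl; last by move=> k; apply/sub3_vanish/sub3_vanish/jacobi_summable.
by apply: eq_isum => j; rewrite /jacobi_term !sub3_mono monoM mul1r.
Qed.

Lemma eis_dissect : dtheta omega omega2 0 1 = isum (fun j =>
  mono (eis_coef (3 * j)) (3 * expA 1 2 j) +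
  mono (eis_coef (3 * j + 1)) (1 + 3 * (3 * 'C(j.+1, 2))) +
  mono (eis_coef (3 * j + 2)) (3 * expB 1 2 j)).
Proof.
rewrite eis_dtheta (@isum_block _ _ 3) //; last first.
  by apply: mono_summable => k; rewrite bin2S leq_addr.
apply: eq_isum => j; rewrite (sum3 (fun r => mono (eis_coef (3 * j + r)) 'C((3 * j + r).+1, 2))) addn0.
by rewrite binE0 binE1 binE2.
Qed.

(** The derivative of the triple product at u = omega.  Since
    (1 - y)(1 - omega y)(1 - omega^2 y) = 1 - y^3, the product is (q^3;q^3)_oo. *)
Lemma eis_identity : dtheta omega omega2 0 1 =
  fps_map (quad_in (-1) (-1)) (sub3 phi) *
  (- mono omega 0 +
    mono (((-3, -3) : int * int) : eis) 0 * fps_map (quad_in (-1) (-1)) (divsum chi3)).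
Proof.
rewrite (@dtheta_product eis omega omega2 0 1 omega3 isT) eis_euler eis_lambert mulrA -mono1.
by rewrite -monoN -[mono 1 0 + _]monoD monoM addn0.
Qed.

Lemma eis_pr1 : pr1 (dtheta omega omega2 0 1) = - (sub3 phi * divsum chi3) *+ 3.
Proof.
rewrite eis_identity pr1M pr1_map pr2_map mul0r mulr0 addr0 raddfD raddfN /=.
rewrite pr1M !pr1_mono pr1_map pr2_map mulr0 mulr0 addr0 mono0 oppr0 add0r.
by rewrite /= [-3](_ : _ = - 1 *+ 3) // -monoMn monoN mono1; ring.
Qed.

Lemma eis_pr2 : pr2 (dtheta omega omega2 0 1) =
  - sub3 phi - (sub3 phi * divsum chi3) *+ 3.
Proof.
rewrite eis_identity pr2M pr1_map pr2_map !mul0r mulr0 !addr0 raddfD raddfN /=.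
rewrite pr2M !pr1_mono !pr2_mono pr1_map pr2_map !mulr0 addr0 add0r /= mono1.
by rewrite [-3](_ : _ = - 1 *+ 3) // -monoMn monoN mono1; ring.
Qed.

(** The Lambert series cancels in the difference of the two components of
    eis_identity. *)
Theorem pentagonal : phi = atheta 1 2.
Proof.
apply: sub3_inj; have -> : sub3 phi =
  pr1 (dtheta omega omega2 0 1) - pr2 (dtheta omega omega2 0 1).
  by rewrite eis_pr1 eis_pr2; ring.
rewrite sub3_pentagonal eis_dissect pr1_isum pr2_isum -isumB.
apply: eq_isum => j; rewrite eis_coef0 eis_coef1 eis_coef2 !pr1D !pr2D !pr1_mono !pr2_mono.
cbn [fst snd].
set A := (3 * expA _ _ _)%N; set B := (3 * expB _ _ _)%N.
have e (c d : int) m : mono c m - mono d m = mono (c - d) m by rewrite -monoN -monoD.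
transitivity (mono ((-1) ^+ j * - (3 * j)%:R - (-1) ^+ j * - (3 * j).+1%:R) A
  + mono ((-1) ^+ j * - (3 * j + 3)%:R - (-1) ^+ j * - (3 * j + 2)%:R) B : fps int).
  by rewrite -!e; ring.
rewrite -monoN; congr (mono _ _ + mono _ _).
  by rewrite -mulrBr -natr1; ring.
by rewrite -mulrBr !natrD; ring.
Qed.

Lemma fps_mulrn3_inj (f g : fps int) : f *+ 3 = g *+ 3 -> f = g.
Proof.
move=> /fpsP e; apply/fpsP => n; have := e n; rewrite !fpsMnE; lia.
Qed.

(** The rational component of eis_identity.  On the side of the series, the
    indices congruent to 1 modulo 3 form Jacobi's series in q^9. *)
Theorem lambert_dissection :
  sub3 phi * divsum chi3 = sub3 (datheta 1 2) + mono 1 1 * sub3 (sub3 (phi ^+ 3)).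
Proof.
apply: fps_mulrn3_inj; apply: oppr_inj; rewrite -mulNrn -eis_pr1 eis_dissect pr1_isum.
rewrite jacobi_cube sub3_dpentagonal sub3_jacobi -isumD !mulrS mulr0n addr0 -!isumD -isumN.
apply: eq_isum => j; rewrite eis_coef0 eis_coef1 eis_coef2 !pr1D !pr1_mono.
cbn [fst snd]; have e (c : int) m : mono ((-1) ^+ j * - c) m =
    - (mono ((-1) ^+ j) 0 * mono c m) by rewrite monoM mulrN monoN.
have e' (c : int) m : mono ((-1) ^+ j * c) m = mono ((-1) ^+ j) 0 * mono c m.
  by rewrite monoM.
have n3 (k : nat) m : mono (3 * k)%:R m = mono k%:R m *+ 3 :> fps int.
  by rewrite monoMn natrM mulr_natl.
rewrite !e !e' (_ : 6 * j + 3 = 3 * (2 * j + 1))%N; last by lia.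
rewrite (_ : 3 * j + 3 = 3 * j.+1)%N; last by lia.
by rewrite !n3; ring.
Qed.

(** * Dissections modulo 3 *)

Section TripleExponents.
Variable i : nat.
Lemma expA12_0 : expA 1 2 (3 * i) = (3 * expA 4 5 i)%N.
Proof. by rewrite /expA bin2_3; lia. Qed.
Lemma expB12_0 : expB 1 2 (3 * i) = (1 + 3 * expA 2 7 i)%N.
Proof. by rewrite /expA /expB bin2S bin2_3; lia. Qed.
Lemma expA12_1 : expA 1 2 (3 * i + 1) = (2 + 3 * expA 1 8 i)%N.
Proof. by rewrite /expA addn1 bin2S bin2_3; lia. Qed.
Lemma expB12_1 : expB 1 2 (3 * i + 1) = (2 + 3 * expB 1 8 i)%N.
Proof. by rewrite /expB addn1 !bin2S bin2_3; lia. Qed.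
Lemma expA12_2 : expA 1 2 (3 * i + 2) = (1 + 3 * expB 2 7 i)%N.
Proof. by rewrite /expA /expB addn2 !bin2S bin2_3; lia. Qed.
Lemma expB12_2 : expB 1 2 (3 * i + 2) = (3 * expB 4 5 i)%N.
Proof. by rewrite /expB addn2 !bin2S bin2_3; lia. Qed.
End TripleExponents.

Lemma sign30 j : (-1 : int) ^+ (3 * j) = (-1) ^+ j.
Proof. by have := sign3 int j 0; rewrite addn0 mulr1. Qed.
Lemma sign31 j : (-1 : int) ^+ (3 * j + 1) = - (-1) ^+ j.
Proof. by rewrite sign3 expr1 mulrN1. Qed.
Lemma sign32 j : (-1 : int) ^+ (3 * j + 2) = (-1) ^+ j.
Proof. by rewrite sign3 mulr1. Qed.

Lemma monoE3 r (c : int) m : mono c (r + 3 * m) = mono 1 r * sub3 (mono c m).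
Proof. by rewrite sub3_mono monoM mul1r. Qed.

Lemma sub3_atheta a c : (0 < c)%N -> sub3 (atheta a c) = isum (fun k => sub3 (atheta_term a c k)).
Proof. by move=> c0; rewrite sub3_isum //; exact: atheta_summable. Qed.
Lemma sub3_datheta a c : (0 < c)%N -> sub3 (datheta a c) = isum (fun k => sub3 (datheta_term a c k)).
Proof. by move=> c0; rewrite sub3_isum //; exact: datheta_summable. Qed.

Lemma isum_sub3 r (F : nat -> fps int) : summable F ->
  mono 1 r * isum (fun k => sub3 (F k)) = isum (fun k => mono 1 r * sub3 (F k)).
Proof. by move=> F0; rewrite isumMl // => k; exact/sub3_vanish/F0. Qed.

(** In each half of the pentagonal series the residue of the index modulo 3
    determines that of the exponent. *)
Lemma atheta_dissect : atheta 1 2 =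
  sub3 (atheta 4 5) - mono 1 1 * sub3 (atheta 2 7) - mono 1 2 * sub3 (atheta 1 8).
Proof.
rewrite !sub3_atheta // !isum_sub3; try exact: atheta_summable.
rewrite /atheta (@isum_block _ _ 3) //; last exact: atheta_summable.
rewrite -!isumB; apply: eq_isum => j; rewrite (sum3 (fun r => atheta_term 1 2 (3 * j + r))).
rewrite addn0 /atheta_term expA12_0 expB12_0 expA12_1 expB12_1 expA12_2 expB12_2.
rewrite sign30 sign31 sign32 !monoN !monoE3 -(sub3_mono _ (expA 4 5 j)).
by rewrite -(sub3_mono _ (expB 4 5 j)) !rmorphB /=; ring.
Qed.

(** The derivative weighs the index 3 i + r by itself, so that every class is
    three times its own derivative plus a multiple of the undifferentiated class. *)
Lemma datheta_dissect : datheta 1 2 = sub3 (datheta 4 5) *+ 3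
  + mono 1 1 * (sub3 (datheta 2 7) *+ 3 + sub3 (atheta 2 7))
  - mono 1 2 * (sub3 (datheta 1 8) *+ 3 + sub3 (atheta 1 8)).
Proof.
rewrite !mulrDr !sub3_atheta // !sub3_datheta //.
rewrite !isum_sub3; try exact: atheta_summable; try exact: datheta_summable.
rewrite /datheta (@isum_block _ _ 3) //; last exact: datheta_summable.
rewrite !mulrS !mulr0n !addr0 -!isumD -!isumB.
apply: eq_isum => j; rewrite (sum3 (fun r => datheta_term 1 2 (3 * j + r))).
rewrite addn0 /atheta_term /datheta_term expA12_0 expB12_0 expA12_1 expB12_1 expA12_2 expB12_2.
rewrite sign30 sign31 sign32 !mulNr !monoN.
have e (k : nat) m : mono ((-1) ^+ j * k%:R) m = mono ((-1) ^+ j) m *+ k :> fps int.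
  by rewrite monoMn mulr_natr.
have sD (f g : fps int) : sub3 (f + g) = sub3 f + sub3 g := rmorphD _ f g.
have sB (f g : fps int) : sub3 (f - g) = sub3 f - sub3 g := rmorphB _ f g.
have sMn (f : fps int) k : sub3 (f *+ k) = sub3 f *+ k := rmorphMn _ k f.
rewrite !e !monoE3 -(sub3_mono _ (expA 4 5 j)) -(sub3_mono _ (expB 4 5 j)).
rewrite !(sD, sB, sMn); ring.
Qed.

(** * Theta functions with integral coefficients *)

Section IntegralTheta.
Variables a c : nat.
Hypotheses (a_gt0 : (0 < a)%N) (c_gt0 : (0 < c)%N).
Let b := (a + c)%N.
Let b_gt0 : (0 < b)%N. Proof. by rewrite /b addn_gt0 a_gt0. Qed.

Definition atheta_factor i : fps int :=
  (1 - mono 1 (a + b * i)) * (1 - mono 1 (c + b * i)) * (1 - mono 1 (b * i.+1)).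

Let one_mono (m k : nat) : (0 < m)%N -> multipliable (fun i => 1 - mono (1 : int) (k + m * i)).
Proof.
move=> m_gt0 i; rewrite addrAC subrr sub0r; apply/vanishN/vanish_mono.
by rewrite (leq_trans (leq_pmull i m_gt0)) ?leq_addl.
Qed.

Lemma athetaE : atheta a c = theta 1 1 a c.
Proof.
apply: eq_isum => k; rewrite !expr1n !mulr1 exprS mulN1r.
by rewrite /atheta_term monoN.
Qed.

Lemma dathetaE : datheta a c = - dtheta 1 1 a c.
Proof.
rewrite -isumN; apply: eq_isum => k; rewrite !expr1n exprS mulN1r !mulNr !monoN.
by rewrite -opprD opprK.
Qed.

Lemma theta_factor_iprod : (1 - mono 1 a) * iprod (theta_factor (1 : int) 1 a c) = iprod atheta_factor.
Proof.
have ma := one_mono a b_gt0; have mc := one_mono c b_gt0.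
have mb := @euler_multipliable int _ b_gt0.
rewrite [iprod atheta_factor](iprodM (multipliableM ma mc) mb) (iprodM ma mc).
rewrite (iprod_recl ma) muln0 addn0 -!mulrA; congr (_ * _).
have ma' := multipliable_shift ma.
by rewrite mulrA -(iprodM ma' mc) -(iprodM (multipliableM ma' mc) mb).
Qed.

Lemma atheta_product : atheta a c = iprod atheta_factor.
Proof. by rewrite athetaE (@theta_product int 1 1 a c (mulr1 1) c_gt0) theta_factor_iprod. Qed.

(** An odd function modulo a + c, since c = - a there *)
Definition rsign d : int := (d %% b == a)%N%:R - (d %% b == c)%N%:R.

(** q^m / (1 - q^m), the indicator series of the positive multiples of m *)
Definition inv_term m : fps int := mono 1 m * geo 1 m.

Lemma inv_termE m n : (0 < m)%N -> inv_term m n = ((m %| n) && (0 < n))%N%:R.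
Proof. by move=> m_gt0; rewrite /inv_term mono_geoE //; case: ifP => _ //; rewrite expr1n. Qed.

Let inv_term_summable k : summable (fun i => inv_term (k + b * i)).
Proof.
by move=> i; apply/vanishMl/vanish_mono; rewrite (leq_trans (leq_pmull i b_gt0)) ?leq_addl.
Qed.

Lemma sum_residue k (F : nat -> int) N : (0 < k)%N -> (k < b)%N ->
  \sum_(i < N) F (k + b * i)%N = \sum_(d < b * N) F d.+1 * (d.+1 %% b == k)%N%:R.
Proof.
move=> k_gt0 k_ltb; rewrite (big_ord_block _ (fun d => F d.+1 * (d.+1 %% b == k)%N%:R)).
apply: eq_bigr => i _; have k1 : (k.-1 < b)%N by rewrite (leq_ltn_trans (leq_pred k)).
rewrite (bigD1 (Ordinal k1)) //= big1 ?addr0; last first.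
  move=> r /eqP r_k; rewrite -addnS mulnC modnMDl.
  have [lt_rb|le_br] := ltnP r.+1 b.
    rewrite modn_small //; case: eqP => [e|]; last by rewrite mulr0.
    by case: r_k; apply/val_inj; rewrite /= -e.
  have -> : (r.+1 = b)%N by apply/eqP; rewrite eqn_leq ltn_ord.
  by rewrite modnn eq_sym gtn_eqF ?mulr0.
by rewrite -addnS prednK // mulnC modnMDl modn_small // eqxx mulr1 addnC.
Qed.

Lemma divsum_rsign : divsum rsign =
  isum (fun i => inv_term (a + b * i)) - isum (fun i => inv_term (c + b * i)).
Proof.
apply/fpsP => n; rewrite fpsBE /isum !fps_sumE; case: n => [|n].
  by rewrite divsum0 !big_ord1 !inv_termE ?andbF ?subrr // ?addn_gt0 ?a_gt0 ?c_gt0.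
rewrite (@divsumE _ n.+1 (b * n.+2)) //; last first.
  by rewrite (leq_trans (leqnSn _)) // leq_pmull.
under [\sum_(i < _) inv_term (a + _) _]eq_bigr => i _ do
  rewrite inv_termE ?addn_gt0 ?a_gt0 // andbT.
under [\sum_(i < _) inv_term (c + _) _]eq_bigr => i _ do
  rewrite inv_termE ?addn_gt0 ?c_gt0 // andbT.
have lt_ab : (a < b)%N by rewrite /b -[a in (a < _)%N]addn0 ltn_add2l.
have lt_cb : (c < b)%N by rewrite /b -[c in (c < _)%N]add0n ltn_add2r.
rewrite (@sum_residue a (fun d => (d %| n.+1)%:R)) //.
rewrite (@sum_residue c (fun d => (d %| n.+1)%:R)) //.
by rewrite -sumrB; apply: eq_bigr => d _; rewrite /rsign mulrBr.
Qed.

(** The logarithmic derivative of a product of factors 1 - q^m is a combination of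
    the series q^m / (1 - q^m), which count divisors. *)
Lemma datheta_lambert : datheta a c = atheta a c * divsum rsign.
Proof.
rewrite dathetaE (@dtheta_product int 1 1 a c (mulr1 1) c_gt0) atheta_product -theta_factor_iprod.
have sa := inv_term_summable a.
have -> : divsum rsign = inv_term a + isum (fun i => inv_term (a + b * i.+1))
    - isum (fun i => inv_term (c + b * i)).
  rewrite divsum_rsign (isum_recl sa); congr (inv_term _ + _ - _).
  by rewrite muln0 addn0.
rewrite isumB; set S := isum (fun i => inv_term (a + b * i.+1)).
set S' := isum (fun i => inv_term (c + b * i)); set P := iprod _.
have ea : (1 - mono 1 a) * inv_term a = mono (1 : int) a.
  by rewrite mulrCA geoM // mulr1.
transitivity (- (P * (- mono 1 a + (1 - mono 1 a) * (S' - S)))); first by [].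
rewrite -{1}ea; ring.
Qed.
End IntegralTheta.

(** * The dissection of the generating function *)

Lemma fps_mulIf (R : comNzRingType) (f g h : fps R) :
  f 0%N = 1 -> f * g = f * h -> g = h.
Proof.
move=> f0 e; have fV : f * fps_inv f = 1 by apply/funext; exact: fps_mulV.
by rewrite -[g]mul1r -[h]mul1r -fV mulrAC e mulrAC.
Qed.

Lemma iprod0 (R : comNzRingType) (F : nat -> fps R) : iprod F 0%N = F 0%N 0%N.
Proof. by rewrite /iprod big_ord1. Qed.

Lemma phi0 : phi 0%N = 1.
Proof. by rewrite /phi iprod0 fpsBE monoE mul0r subr0. Qed.

Lemma sub3_phi0 : sub3 phi 0%N = 1. Proof. exact: phi0. Qed.

Local Notation L := (divsum chi3).
Local Notation L1 := (res 1 (divsum chi3)).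
Local Notation X := (mono (1 : int) 1).

Lemma phi_L : phi * L = datheta 1 2.
Proof.
have := congr1 (res 0) lambert_dissection.
by rewrite res_sub3mul // resD res_sub3 // res_mono1 //= addr0 res0_divsum_chi3.
Qed.

Lemma phi_L1 : phi * L1 = sub3 (phi ^+ 3).
Proof.
have := congr1 (res 1) lambert_dissection.
by rewrite res_sub3mul // resD res_sub3 // res_mono1 //= add0r.
Qed.

Section Sub3Morphism.
Implicit Types f g : fps int.
Lemma sub3M f g : sub3 (f * g) = sub3 f * sub3 g. Proof. exact: rmorphM. Qed.
Lemma sub3D f g : sub3 (f + g) = sub3 f + sub3 g. Proof. exact: rmorphD. Qed.
Lemma sub3N f : sub3 (- f) = - sub3 f. Proof. exact: rmorphN. Qed.
Lemma sub3Mn f k : sub3 (f *+ k) = sub3 f *+ k. Proof. exact: rmorphMn. Qed.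
Lemma sub3_1 : sub3 1 = 1 :> fps int. Proof. exact: rmorph1. Qed.
Definition sub3E := (sub3M, sub3D, sub3N, sub3Mn, sub3_1).
End Sub3Morphism.

Lemma jacobi_dissect : phi ^+ 3 =
  sub3 (datheta 1 2) *+ 6 + sub3 (atheta 1 2) - (X * sub3 (sub3 (phi ^+ 3))) *+ 3.
Proof.
rewrite jacobi_cube sub3_datheta // sub3_atheta // sub3_jacobi.
rewrite [isum jacobi_term](@isum_block _ _ 3) //; last exact: jacobi_summable.
rewrite !mulrS !mulr0n !addr0 -!isumD -!isumB.
apply: eq_isum => j; rewrite (sum3 (fun r => jacobi_term (3 * j + r))) addn0.
rewrite /jacobi_term binE0 binE1 binE2 sign30 sign31 sign32 !mulNr !monoN.
have e (k : nat) m : mono ((-1) ^+ j * k%:R) m = mono ((-1) ^+ j) m *+ k :> fps int.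
  by rewrite monoMn mulr_natr.
rewrite /datheta_term /atheta_term !e.
by rewrite !sub3E !sub3_mono; ring.
Qed.

(** The identity b(q) = a(q^3) - c(q^3) of the Borweins, where b is the cube of
    (q) divided by (q^3), a = 1 + 6 L and c(q^3) = 3 q L1(q^3). *)
Lemma phi_cube : phi ^+ 3 = sub3 phi * (sub3 (1 + L *+ 6) - X * sub3 L1 *+ 3).
Proof.
rewrite {1}jacobi_dissect -phi_L -pentagonal -phi_L1.
by rewrite !sub3E; ring.
Qed.

Lemma divsumD p1 p2 : divsum p1 + divsum p2 = divsum (fun d => p1 d + p2 d).
Proof.
apply/fpsP => n; rewrite fpsDE /divsum -big_split /=.
by apply: eq_bigr => d _; rewrite mulrDr.
Qed.
Lemma divsumN p : - divsum p = divsum (fun d => - p d).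
Proof.
by apply/fpsP => n; rewrite fpsNE /divsum -sumrN; apply: eq_bigr => d _; rewrite mulrN.
Qed.

Lemma chi3_rsign : L = divsum (rsign 1 8) - divsum (rsign 2 7) + divsum (rsign 4 5).
Proof.
rewrite divsumN !divsumD; apply: eq_divsum => d; rewrite /rsign /chi3 /=.
rewrite -(modn_dvdm d (isT : (3 %| 9)%N)).
have := ltn_pmod d (isT : (0 < 9)%N); move: (d %% 9)%N.
by do 9 case=> //.
Qed.

Lemma X2 : mono 1 2 = X * X. Proof. by rewrite monoM. Qed.
Lemma sub3X : sub3 X = X * X * X. Proof. by rewrite sub3_mono !monoM. Qed.

Lemma dissect3 (A B C A' B' C' : fps int) :
  sub3 A + X * sub3 B + X * X * sub3 C = sub3 A' + X * sub3 B' + X * X * sub3 C' ->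
  [/\ A = A', B = B' & C = C'].
Proof.
rewrite -X2 => e; split.
- by move/(congr1 (res 0)): e; rewrite !resD !res_sub3 // !res_mono1 // !res_mono2 //= !addr0.
- by move/(congr1 (res 1)): e; rewrite !resD !res_sub3 // !res_mono1 // !res_mono2 //= !addr0 !add0r.
- by move/(congr1 (res 2)): e; rewrite !resD !res_sub3 // !res_mono1 // !res_mono2 //= !add0r.
Qed.

Section Dissect.
Variable G : fps int.
Hypothesis GE : G * sub3 phi ^+ 2 = phi ^+ 4.

Local Notation x := (atheta 4 5).
Local Notation y := (atheta 2 7).
Local Notation z := (atheta 1 8).

(* The classes of phi * L, from the two factors and from phi_L. *)
Let res_phi_L : [/\ x * L - X * (z * L1) = datheta 4 5 *+ 3,
  x * L1 - y * L = datheta 2 7 *+ 3 + y & - (z * L) - y * L1 = - (datheta 1 8 *+ 3 + z)].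
Proof.
have e : phi * L = (sub3 x - X * sub3 y - mono 1 2 * sub3 z) * L.
  by rewrite pentagonal atheta_dissect.
rewrite phi_L datheta_dissect [in RHS]divsum_chi3_dissect X2 in e.
apply: dissect3; rewrite !sub3E sub3X; transitivity ((sub3 x - X * sub3 y - X * X * sub3 z) *
  (sub3 L + X * sub3 L1)); first by ring.
by rewrite -e; ring.
Qed.

Let G_phi : G * sub3 phi = phi * (sub3 (1 + L *+ 6) - X * sub3 L1 *+ 3).
Proof.
apply: (fps_mulIf sub3_phi0); transitivity (phi * phi ^+ 3).
  by rewrite -exprS -GE; ring.
by rewrite phi_cube; ring.
Qed.

Let G_res : [/\ phi * res 0 G = x * (1 + L *+ 6) + X * (z * L1) *+ 3,
  phi * res 1 G = - (y * (1 + L *+ 6)) - x * L1 *+ 3 &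
  phi * res 2 G = - (z * (1 + L *+ 6)) + y * L1 *+ 3].
Proof.
have Gd : G = sub3 (res 0 G) + X * sub3 (res 1 G) + X * X * sub3 (res 2 G).
  by rewrite -X2; apply: fps_resP; rewrite !resD !res_sub3 // !res_mono1 // !res_mono2 //= ?addr0 ?add0r.
apply: dissect3; rewrite !sub3E sub3X.
transitivity (G * sub3 phi); first by rewrite [in RHS]Gd; ring.
by rewrite G_phi {1}pentagonal atheta_dissect X2 !sub3E; ring.
Qed.

(** L1 is eliminated between G_res and res_phi_L.  What remains is a combination of
    L with one logarithmic derivative, and chi3_rsign makes it a pair of signs
    modulo 9; likewise in the two other classes. *)
Lemma res0_G : phi * res 0 G = x * (1 + (divsum (rsign 1 8) - divsum (rsign 2 7)) *+ 9).
Proof.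
have [-> _ _] := G_res; have [e _ _] := res_phi_L.
have -> : X * (z * L1) = x * L - datheta 4 5 *+ 3 by rewrite -e; ring.
by rewrite datheta_lambert // chi3_rsign; ring.
Qed.

Lemma res1_G : phi * res 1 G = - (y * (1 *+ 4 + (divsum (rsign 1 8) + divsum (rsign 4 5)) *+ 9)).
Proof.
have [_ -> _] := G_res; have [_ e _] := res_phi_L.
have -> : x * L1 = y * L + (datheta 2 7 *+ 3 + y) by rewrite -e; ring.
by rewrite datheta_lambert // chi3_rsign; ring.
Qed.

Lemma res2_G : phi * res 2 G = z * (1 *+ 2 + (divsum (rsign 2 7) - divsum (rsign 4 5)) *+ 9).
Proof.
have [_ _ ->] := G_res; have [_ _ e] := res_phi_L.
have -> : y * L1 = datheta 1 8 *+ 3 + z - z * L.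
  by rewrite -[datheta 1 8 *+ 3 + z]opprK -e; ring.
by rewrite datheta_lambert // chi3_rsign; ring.
Qed.

End Dissect.

(** * Positivity *)

Definition nneg (f : fps int) := forall n, 0 <= f n.
Definition normal (f : fps int) := nneg f /\ f 0%N = 1.

Lemma nnegM f g : nneg f -> nneg g -> nneg (f * g).
Proof. by move=> f0 g0 n; rewrite fpsME sumr_ge0 // => i _; rewrite mulr_ge0. Qed.

Lemma normal1 : normal 1.
Proof. by split=> // n; rewrite fps1E ler0n. Qed.

Lemma normalM f g : normal f -> normal g -> normal (f * g).
Proof.
by case=> f0 f1 [g0 g1]; split; [exact: nnegM | rewrite fps_mul0E f1 g1 mulr1].
Qed.

Lemma normal_prod I (r : seq I) (P : pred I) (F : I -> fps int) :
  (forall i, P i -> normal (F i)) -> normal (\prod_(i <- r | P i) F i).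
Proof. by move=> F1; apply: big_ind => //; [exact: normal1 | exact: normalM]. Qed.

Lemma normal_iprod F : (forall i, normal (F i)) -> normal (iprod F).
Proof.
move=> F1; split=> [n|]; last by rewrite iprod0; case: (F1 0%N).
have [+ _] : normal (\prod_(i < n.+1) F i) by apply: normal_prod.
exact.
Qed.

Lemma normal_geo m : (0 < m)%N -> normal (geo 1 m).
Proof.
move=> m_gt0; split=> [n|]; rewrite /geo; last by rewrite dvdn0 div0n.
by case: ifP => // _; rewrite expr1n.
Qed.

Lemma ler_mul_normal f g n : nneg f -> normal g -> f n <= (f * g) n.
Proof.
move=> f0 [g0 g1]; rewrite fpsME big_ord_recr /= subnn g1 mulr1 lerDr.
by rewrite sumr_ge0 // => i _; rewrite mulr_ge0.
Qed.

Lemma mul_geo1E (f : fps int) n : (f * geo 1 1) n = \sum_(i < n.+1) f i.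
Proof.
by rewrite fpsME; apply: eq_bigr => i _; rewrite /geo dvd1n expr1n mulr1.
Qed.

(** ** Reciprocal products *)

Definition rprod (s : seq nat) : fps int :=
  iprod (fun i => \prod_(r <- s) geo 1 (r + 9 * i)).

Lemma rprod_multipliable s : all (leq 1) s ->
  multipliable (fun i => \prod_(r <- s) geo (1 : int) (r + 9 * i)).
Proof.
move=> /allP s_gt0 i; rewrite big_seq.
apply: (@vanish_prod1 int) => r /s_gt0 r_gt0 n lt_ni.
rewrite fpsBE fps1E /geo expr1n; case: n lt_ni => [|n] lt_ni.
  by rewrite dvdn0 subrr.
by rewrite gtnNdvd ?subrr //; lia.
Qed.

Lemma normal_rprod_tail s :
  normal (iprod (fun i => \prod_(r <- s) geo 1 (r + 9 * i.+1))).
Proof.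
apply: normal_iprod => i; apply: normal_prod => r _; apply: normal_geo.
by rewrite mulnS addnCA.
Qed.

Lemma rprod_recl s : all (leq 1) s -> rprod s =
  (\prod_(r <- s) geo 1 r) * iprod (fun i => \prod_(r <- s) geo 1 (r + 9 * i.+1)).
Proof.
move=> s_gt0; rewrite /rprod (iprod_recl (rprod_multipliable s_gt0)) muln0.
by under eq_bigr do rewrite addn0.
Qed.

(** The factors of the Euler product that do not occur in the theta product form
    the denominator of the quotient. *)
Lemma atheta_rprod a c s : (a + c = 9)%N -> perm_eq (iota 1 8) [:: a, c & s] ->
  atheta a c = phi * rprod s.
Proof.
move=> ac perm_s.
have s_gt0 : all (leq 1) [:: a, c & s] by rewrite -(perm_all _ perm_s).
have /and3P[a_gt0 c_gt0 _] := s_gt0.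
have s_gt0' : all (leq 1) s by case/and3P: s_gt0.
have phi9 := @iprod_block _ _ 9 isT phi_multipliable; rewrite atheta_product // /phi phi9.
rewrite /rprod -iprodM; last exact: rprod_multipliable.
  apply: eq_iprod => i; rewrite /atheta_factor ac big_ord_recr /= mulnS [(9 + _)%N]addnC.
  rewrite -addnS.
  have -> : \prod_(r < 8) (1 - mono (1 : int) (9 * i + r).+1) =
      \prod_(r <- iota 1 8) (1 - mono 1 (r + 9 * i)).
    rewrite -[1%N]addn0 iotaDl big_map -/(index_iota 0 8) big_mkord.
    by apply: eq_bigr => r _; rewrite -addnS addnC.
  have -> : \prod_(r <- iota 1 8) (1 - mono (1 : int) (r + 9 * i)) =
      (1 - mono 1 (a + 9 * i)) * ((1 - mono 1 (c + 9 * i)) *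
      \prod_(r <- s) (1 - mono 1 (r + 9 * i))).
    by rewrite (perm_big _ perm_s) !big_cons.
  transitivity ((1 - mono (1 : int) (a + 9 * i)) * (1 - mono 1 (c + 9 * i)) *
    (1 - mono 1 (9 * i + 9)) *
    (\prod_(r <- s) (1 - mono 1 (r + 9 * i)) * \prod_(r <- s) geo 1 (r + 9 * i)));
    last by ring.
  rewrite -big_split /= big_seq big1 ?mulr1 // => r rs.
  by rewrite geoM // addn_gt0 (allP s_gt0' r rs).
exact: multipliable_block phi_multipliable.
Qed.

(** ** Abel summation *)

(** n %/ d counts the multiples of d up to n. *)
Lemma sum_divsum p n : \sum_(i < n.+1) divsum p i = \sum_(d < n) p d.+1 * (n %/ d.+1)%:R.
Proof.
elim: n => [|n IHn]; first by rewrite big_ord1 big_ord0 divsum0.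
rewrite big_ord_recr /= IHn (@divsumE _ n.+1 n.+1) // [in RHS]big_ord_recr /=.
rewrite [X in _ + X]big_ord_recr /= addrA -big_split /= divnn dvdnn /= mul1r mulr1.
congr (_ + _); apply: eq_bigr => d _.
by rewrite divnS // natrD; ring.
Qed.

Lemma abel_ge0 (p w : nat -> int) :
  (forall n, 0 <= \sum_(d < n) p d) -> (forall d, 0 <= w d) ->
  (forall d, w d.+1 <= w d) -> forall n, 0 <= \sum_(d < n) p d * w d.
Proof.
move=> p0 w0 w_dec [|n]; first by rewrite big_ord0.
suff: (\sum_(d < n.+1) p d) * w n <= \sum_(d < n.+1) p d * w d.
  by apply: le_trans; rewrite mulr_ge0.
elim: n => [|n IHn]; first by rewrite !big_ord1.
rewrite big_ord_recr [in leRHS]big_ord_recr /= mulrDl lerD2r.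
by apply: le_trans IHn; apply: ler_wpM2l; [exact: p0 | exact: w_dec].
Qed.

Lemma sum_divn_ge0 (p : nat -> int) n :
  (forall m, 0 <= \sum_(d < m) p d.+1) ->
  0 <= \sum_(d < n) p d.+1 * (n %/ d.+1)%:R.
Proof.
move=> p0; apply: (@abel_ge0 (fun d => p d.+1) (fun d => (n %/ d.+1)%:R)) => // d.
by rewrite ler_nat leq_div2l.
Qed.

Lemma sum_periodic_ge0 (p : nat -> int) :
  (forall d, p (d + 9)%N = p d) -> \sum_(d < 9) p d.+1 = 0 ->
  (forall m, (m < 9)%N -> 0 <= \sum_(d < m) p d.+1) ->
  forall m, 0 <= \sum_(d < m) p d.+1.
Proof.
move=> p9 p_sum p0 m; have pM k d : p (9 * k + d)%N = p d.
  elim: k => // k IHk; rewrite -IHk -[in RHS]p9; congr p; lia.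
rewrite (divn_eq m 9) mulnC big_split_ord /= (@big_ord_block _ _ _ (fun d => p d.+1)).
rewrite big1 ?add0r => [|k _]; last first.
  by rewrite -[RHS]p_sum; apply: eq_bigr => r _; rewrite -addnS pM.
under eq_bigr do rewrite -addnS pM.
by apply: p0; rewrite ltn_mod.
Qed.

(** ** Signs of the coefficients *)

(** The factor 1 / (1 - q) sums the coefficients of f; the other factors preserve
    lower bounds. *)
Lemma rprod_mul_gt0 s f n : all (leq 1) s ->
  (forall m, 0 < (f * geo 1 1) m) -> 0 < (rprod (1%N :: s) * f) n.
Proof.
move=> s_gt0 fpos; rewrite (@rprod_recl (1%N :: s)) // big_cons.
set P := \prod_(r <- s) _; set T := iprod _.
have nP : normal P.
  by rewrite /P big_seq; apply: normal_prod => r rs; apply/normal_geo/(allP s_gt0).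
have nT : normal T by apply: (@normal_rprod_tail (1%N :: s)).
have -> : geo 1 1 * P * T * f = (f * geo 1 1) * (P * T) by ring.
apply: lt_le_trans (fpos n) _; apply: ler_mul_normal; last exact: normalM.
by move=> m; apply: ltW.
Qed.

Lemma rsign_periodic a c d : (a + c = 9)%N -> rsign a c (d + 9) = rsign a c d.
Proof. by move=> ac; rewrite /rsign ac modnDr. Qed.

Lemma affine_divsum_geo (k : nat) p n :
  ((1 *+ k + divsum p *+ 9) * geo 1 1) n =
  k%:R + (\sum_(d < n) p d.+1 * (n %/ d.+1)%:R) *+ 9.
Proof.
rewrite mul_geo1E -sum_divsum.
under eq_bigr => i _ do rewrite fpsDE !fpsMnE fps1E.
rewrite big_split /= -!sumrMnl; congr (_ + _).
rewrite big_ord_recl /= big1 ?addr0 // => i _.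
by rewrite mul0rn.
Qed.

Lemma affine_divsum_geo_gt0 (k : nat) p : (0 < k)%N ->
  (forall d, p (d + 9)%N = p d) -> \sum_(d < 9) p d.+1 = 0 ->
  (forall m, (m < 9)%N -> 0 <= \sum_(d < m) p d.+1) ->
  forall n, 0 < ((1 *+ k + divsum p *+ 9) * geo 1 1) n.
Proof.
move=> k_gt0 p9 p_sum p_ge0 n; rewrite affine_divsum_geo.
rewrite ltr_wpDr ?ltr0n // mulrn_wge0 // sum_divn_ge0 //.
exact: sum_periodic_ge0.
Qed.

Definition rsign2 d : int := rsign 2 7 d - rsign 4 5 d.

Lemma rsign2_sum_ge0 m : 0 <= \sum_(d < m) rsign2 d.+1.
Proof.
apply: sum_periodic_ge0 => [d||].
- by rewrite /rsign2 !rsign_periodic.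
- by rewrite !big_ord_recr big_ord0.
by do 9 (case=> [_|]; first by rewrite ?big_ord0 // !big_ord_recr big_ord0).
Qed.

(** The sign is -1 only at divisors that are at least 4; their cofactors are at
    most n / 4. *)
Lemma divsum_rsign2_lower n : - (n %/ 4)%:R <= divsum rsign2 n.
Proof.
rewrite divsum_swap; case: n => [|n]; first by rewrite big_ord0 oppr0.
have -> : - (n.+1 %/ 4)%:R = \sum_(d < n.+1) - (d < n.+1 %/ 4)%N%:R :> int.
  rewrite sumrN; congr (- _).
  move: (n.+1 %/ 4)%N (leq_div n.+1 4) => q le.
  rewrite -[in RHS](subnKC le) big_split_ord /= addrC big1 ?add0r; last first.
    by move=> d _; rewrite ltnNge leq_addr.
  rewrite (eq_bigr (fun=> 1)); first by rewrite sumr_const card_ord.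
  by move=> d _; rewrite /= ltn_ord.
apply: ler_sum => -[d /= _] _; case: dvdnP => [[k ek]|_]; last by rewrite mul0r oppr_le0 ler0n.
rewrite mul1r ek mulnK //; case: ltnP => [_|le_d].
  rewrite /rsign2 /rsign /=; have := ltn_pmod k (isT : (0 < 9)%N).
  by move: (k %% 9)%N; do 9 case=> //.
have : (k < 4)%N.
  rewrite ltnNge; apply/negP => le_4k; move: le_d; rewrite leqNgt => /negP; apply.
  by rewrite leq_divRL // mulnC leq_mul2r le_4k orbT.
by case: k {ek le_d} => [|[|[|[|//]]]].
Qed.

Lemma sum_divn_at (e n : nat) : (0 < e)%N ->
  \sum_(d < n) (d.+1 == e)%N%:R * (n %/ d.+1)%:R = (n %/ e)%:R :> int.
Proof.
move=> e_gt0; have [le_en|lt_ne] := leqP e n.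
  have lt_e : (e.-1 < n)%N by rewrite prednK.
  rewrite (bigD1 (Ordinal lt_e)) //= prednK // eqxx mul1r big1 ?addr0 // => d d_e.
  case: eqP => [ed|]; last by rewrite mul0r.
  by case/eqP: d_e; apply/val_inj; rewrite /= -ed.
rewrite divn_small // big1 // => d _; case: eqP => [ed|]; last by rewrite mul0r.
by have := ltn_ord d; rewrite -ltnS ed ltnS leqNgt lt_ne.
Qed.

(** The partial sums of rsign2 stay nonnegative when the terms at 2 and 4, a first
    plus and minus, are removed; Abel summation applies to the rest. *)
Lemma sum_rsign2_lower n :
  (n %/ 2)%:R - (n %/ 4)%:R <= \sum_(d < n) rsign2 d.+1 * (n %/ d.+1)%:R.
Proof.
rewrite -(@sum_divn_at 2) // -(@sum_divn_at 4) // -subr_ge0 -!sumrB.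
pose p d : int := rsign2 d - ((d == 2)%N%:R - (d == 4)%N%:R).
have -> : \sum_(d < n) (rsign2 d.+1 * (n %/ d.+1)%:R -
    ((d.+1 == 2)%N%:R * (n %/ d.+1)%:R - (d.+1 == 4)%N%:R * (n %/ d.+1)%:R)) =
    \sum_(d < n) p d.+1 * (n %/ d.+1)%:R.
  by apply: eq_bigr => d _; rewrite /p; ring.
apply: sum_divn_ge0 => m; rewrite /p sumrB.
have [lt_m4|le_4m] := ltnP m 4.
  by move: m lt_m4;
    do 4 (case=> [_|]; first by rewrite ?big_ord0 // !big_ord_recr !big_ord0).
rewrite (_ : \sum_(d < m) ((d.+1 == 2)%N%:R - (d.+1 == 4)%N%:R) = 0 :> int) ?subr0; first exact: rsign2_sum_ge0.
rewrite -(subnKC le_4m) big_split_ord /= [X in _ + X]big1; last first.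
  by move=> d _.
by rewrite !big_ord_recr big_ord0.
Qed.

(** This is (1 - q)(1 - q^6) = (1 - q^2)(1 - q^3)(1 - q + q^2).  It creates the
    summation factor 1 / (1 - q) that the product of class 2 lacks. *)
Lemma geo23 : geo 1 2 * geo 1 3 =
  geo 1 1 * (1 - mono 1 1 + mono 1 2) * geo 1 6 :> fps int.
Proof.
have g1 := @geoM int 1 1 isT; have g2 := @geoM int 1 2 isT.
have g3 := @geoM int 1 3 isT; have g6 := @geoM int 1 6 isT.
pose q : fps int := mono 1 1.
have qE m : mono 1 m = q ^+ m by rewrite monoX expr1n mul1n.
rewrite !qE in g1 g2 g3 g6 *.
transitivity (geo 1 2 * geo 1 3 * ((1 - q ^+ 1) * geo 1 1) * ((1 - q ^+ 6) * geo 1 6)).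
  by rewrite g1 g6 !mulr1.
transitivity (geo 1 1 * (1 - q ^+ 1 + q ^+ 2) * geo 1 6 *
  ((1 - q ^+ 2) * geo 1 2) * ((1 - q ^+ 3) * geo 1 3)); last by rewrite g2 g3 !mulr1.
by ring.
Qed.

(** If H n are the sums of the coefficients of 2 + 9 divsum rsign2, the coefficient
    is (H n - H (n-1)) + H (n-2).  For n >= 2 the difference is at least
    - 9 floor(n/4), and H (n-2) is at least
    2 + 9 (floor((n-2)/2) - floor((n-2)/4)) = 2 + 9 floor(n/4). *)
Lemma smoothed_ge (n : nat) :
  let f := (1 *+ 2 + divsum rsign2 *+ 9) * geo 1 1 * (1 - mono 1 1 + mono 1 2) in
  0 <= f n /\ (n != 1%N -> 0 < f n).
Proof.
move=> f; pose H := (1 *+ 2 + divsum rsign2 *+ 9) * geo 1 1 : fps int.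
have fE m : f m = H m - (if (1 <= m)%N then H (m - 1)%N else 0)
     + (if (2 <= m)%N then H (m - 2)%N else 0).
  have -> : f = H - mono 1 1 * H + mono 1 2 * H by rewrite /f -/H; ring.
  by rewrite fpsDE fpsBE !coef_monoM !mul1r.
have HE m : H m = 2%:R + (\sum_(d < m) rsign2 d.+1 * (m %/ d.+1)%:R) *+ 9.
  exact: affine_divsum_geo.
have HB m : H m.+1 - H m = divsum rsign2 m.+1 *+ 9.
  rewrite /H !mul_geo1E [X in X - _]big_ord_recr /= addrAC subrr add0r.
  by rewrite fpsDE !fpsMnE fps1E mul0rn add0r.
case: n => [|[|n]].
- by rewrite fE /= subr0 addr0 HE big_ord0 mul0rn addr0.
- by rewrite fE /= addr0 subnn HB /divsum big_ord1.
suff: 0 < f n.+2 by move=> f_gt0; split=> //; apply: ltW.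
rewrite fE /= !subSS !subn0 HB HE.
have lo := divsum_rsign2_lower n.+2; have lo' := sum_rsign2_lower n.
move: (divsum rsign2 n.+2) (\sum_(d < n) _) lo lo' => A S.
rewrite (_ : n.+2 %/ 4 = n %/ 2 - n %/ 4)%N; last by lia.
rewrite natrB; last by lia.
by lia.
Qed.

Section Signs.
Variable G : fps int.
Hypothesis GE : G * sub3 phi ^+ 2 = phi ^+ 4.

Lemma res0_pos n : 0 < res 0 G n.
Proof.
have -> : res 0 G = rprod [:: 1; 2; 3; 6; 7; 8]%N *
    (1 *+ 1 + divsum (fun d => rsign 1 8 d - rsign 2 7 d) *+ 9).
  apply: (fps_mulIf phi0); rewrite (res0_G GE) divsumN divsumD mulr1n mulrA.
  by rewrite (@atheta_rprod 4 5 [:: 1; 2; 3; 6; 7; 8]%N).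
apply: rprod_mul_gt0 => // m; apply: affine_divsum_geo_gt0 => //.
- by move=> d; rewrite !rsign_periodic.
- by rewrite !big_ord_recr big_ord0.
by do 9 (case=> [_|]; first by rewrite ?big_ord0 // !big_ord_recr big_ord0).
Qed.

Lemma res1_neg n : res 1 G n < 0.
Proof.
have -> : res 1 G = - (rprod [:: 1; 3; 4; 5; 6; 8]%N *
    (1 *+ 4 + divsum (fun d => rsign 1 8 d + rsign 4 5 d) *+ 9)).
  apply: (fps_mulIf phi0); rewrite (res1_G GE) divsumD mulrN mulrA.
  by rewrite (@atheta_rprod 2 7 [:: 1; 3; 4; 5; 6; 8]%N).
rewrite fpsNE oppr_lt0.
apply: rprod_mul_gt0 => // m; apply: affine_divsum_geo_gt0 => //.
- by move=> d; rewrite !rsign_periodic.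
- by rewrite !big_ord_recr big_ord0.
by do 9 (case=> [_|]; first by rewrite ?big_ord0 // !big_ord_recr big_ord0).
Qed.

Lemma res2_pos n : n != 1%N -> 0 < res 2 G n.
Proof.
move=> n1; have -> : res 2 G = rprod [:: 2; 3; 4; 5; 6; 7]%N *
    (1 *+ 2 + divsum rsign2 *+ 9).
  apply: (fps_mulIf phi0); rewrite (res2_G GE) divsumN divsumD mulrA.
  by rewrite (@atheta_rprod 1 8 [:: 2; 3; 4; 5; 6; 7]%N).
rewrite (@rprod_recl [:: 2; 3; 4; 5; 6; 7]%N) // !big_cons big_nil.
set T := iprod _; set f := 1 *+ 2 + _.
have nT : normal T by apply: (@normal_rprod_tail [:: 2; 3; 4; 5; 6; 7]%N).
pose N := geo 1 6 * geo 1 4 * geo 1 5 * geo 1 6 * geo 1 7 * T.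
have nN : normal N by rewrite /N; do ?[apply: normalM]; rewrite //; apply: normal_geo.
rewrite (_ : _ * f = f * geo 1 1 * (1 - mono 1 1 + mono 1 2) * N).
  apply: lt_le_trans (ler_mul_normal n _ nN).
    by have [_ ->] := smoothed_ge n.
  by move=> m; have [] := smoothed_ge m.
transitivity (geo 1 2 * geo 1 3 * (geo 1 4 * geo 1 5 * geo 1 6 * geo 1 7 * T * f)).
  by ring.
by rewrite geo23 /N; ring.
Qed.

End Signs.

(** * Evaluation at a cube root of unity *)

Definition omega_pow (m : int) : eis := omega ^+ `|(m %% 3)%Z|%N.

Lemma omega_powE m : omega_pow m =
  if (m %% 3)%Z == 0 then 1 else if (m %% 3)%Z == 1 then omega else omega2.
Proof.
have m_ge0 : 0 <= (m %% 3)%Z by exact: modz_ge0.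
have m_lt3 : (m %% 3)%Z < 3 by exact: ltz_pmod.
rewrite /omega_pow; case: (m %% 3)%Z m_ge0 m_lt3 => // k _.
by case: k => [|[|[|//]]].
Qed.

Lemma omega_powD i j : omega_pow (i + j) = omega_pow i * omega_pow j.
Proof.
rewrite !omega_powE -modzDm.
have i_ge0 : 0 <= (i %% 3)%Z by exact: modz_ge0.
have i_lt3 : (i %% 3)%Z < 3 by exact: ltz_pmod.
have j_ge0 : 0 <= (j %% 3)%Z by exact: modz_ge0.
have j_lt3 : (j %% 3)%Z < 3 by exact: ltz_pmod.
case: (i %% 3)%Z i_ge0 i_lt3 => // k _; case: (j %% 3)%Z j_ge0 j_lt3 => // l _.
by case: l => [|[|[|//]]] _; case: k => [|[|[|//]]] _.
Qed.

Definition eval_omega : laurent -> eis := mmap (quad_in (-1) (-1)) omega_pow.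

Fact eval_omega_zmod : zmod_morphism eval_omega.
Proof. exact: mmap_is_additive. Qed.
HB.instance Definition _ := GRing.isZmodMorphism.Build laurent eis eval_omega eval_omega_zmod.

Lemma eval_omegaU c m : eval_omega << c *g m >> = quad_in _ _ c * omega_pow m.
Proof. exact: mmapU. Qed.

Fact eval_omega_monoid : monoid_morphism eval_omega.
Proof.
split=> [|f g]; first by rewrite -[1 : laurent]/(zpow 0) /zpow eval_omegaU rmorph1 mul1r.
rewrite -[f * g]/(lmul f g) /lmul raddf_sum.
rewrite [in RHS](_ : eval_omega f = \sum_(i <- msupp f) quad_in _ _ f@_i * omega_pow i) //.
rewrite mulr_suml; apply: eq_bigr => i _; rewrite raddf_sum.
rewrite [in RHS](_ : eval_omega g = \sum_(i <- msupp g) quad_in _ _ g@_i * omega_pow i) //.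
rewrite mulr_sumr; apply: eq_bigr => j _.
by rewrite /= eval_omegaU rmorphM omega_powD; ring.
Qed.
HB.instance Definition _ := GRing.isMonoidMorphism.Build laurent eis eval_omega eval_omega_monoid.

Section PolyCoef.
Variable R : comNzRingType.

Definition fps_of_poly (p : {poly R}) : fps R := fun n => p`_n.

Fact fps_of_poly_zmod : zmod_morphism fps_of_poly.
Proof. by move=> p q; apply/fpsP => n; rewrite fpsBE /fps_of_poly coefB. Qed.
Fact fps_of_poly_monoid : monoid_morphism fps_of_poly.
Proof.
split=> [|p q]; apply/fpsP => n; first by rewrite /fps_of_poly coef1.
by rewrite fpsME /fps_of_poly coefM.
Qed.
HB.instance Definition _ := GRing.isZmodMorphism.Build {poly R} (fps R)
  fps_of_poly fps_of_poly_zmod.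
HB.instance Definition _ := GRing.isMonoidMorphism.Build {poly R} (fps R)
  fps_of_poly fps_of_poly_monoid.

Lemma qpoch_iprod (c : R) :
  qpoch (c%:P * 'X) = iprod (fun i => 1 - mono c i.+1).
Proof.
apply/fpsP => n; rewrite /qpoch /iprod.
have e (i : nat) : fps_of_poly (1 - c%:P * 'X * 'X^i) = 1 - mono c i.+1.
  apply/fpsP => m; rewrite fpsBE /fps_of_poly coefB coef1 -mulrA -exprS coefCM coefXn.
  by rewrite fps1E monoE mulrC.
transitivity (fps_of_poly (\prod_(j < n.+1) (1 - c%:P * 'X * 'X^j)) n); first by [].
by rewrite rmorph_prod; under eq_bigr do rewrite /= e.
Qed.
End PolyCoef.

Lemma one_minus_mono (R : comNzRingType) (c : R) : multipliable (fun i => 1 - mono c i.+1).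
Proof. by move=> i; rewrite addrAC subrr sub0r; apply/vanishN/vanish_mono. Qed.

Local Notation gf := (fps_map eval_omega bicrank_gf).
Local Notation Phi := (fps_map (quad_in (-1) (-1)) phi).
Local Notation Om c := (iprod (fun i => 1 - mono (c : eis) i.+1)).

Lemma eval_omega_qpoch m : fps_map eval_omega (qpoch (zq m)) = Om (omega_pow m).
Proof.
rewrite /zq qpoch_iprod fps_map_iprod; apply: eq_iprod => i.
by rewrite rmorphB rmorph1 /= fps_map_mono /= /zpow eval_omegaU rmorph1 mul1r.
Qed.

Lemma eval_omega_qpochX : fps_map eval_omega (qpoch 'X) = Phi.
Proof.
rewrite -['X]mul1r -polyC1 qpoch_iprod /phi !fps_map_iprod; apply: eq_iprod => i.
by rewrite !rmorphB !rmorph1 /= !fps_map_mono !rmorph1.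
Qed.

Lemma omega_euler : Om omega * Om omega2 * Phi = fps_map (quad_in (-1) (-1)) (sub3 phi).
Proof.
rewrite -eis_euler /phi fps_map_iprod.
have -> : (fun i => fps_map (quad_in (-1) (-1)) (1 - mono 1 i.+1)) =
    (fun i => 1 - mono (1 : eis) i.+1).
  by apply/funext => i; rewrite rmorphB rmorph1 /= fps_map_mono rmorph1.
have mu := @one_minus_mono eis.
rewrite -(iprodM (mu omega) (mu omega2)) -(iprodM (multipliableM (mu _) (mu _)) (mu 1)).
by apply: eq_iprod => i; rewrite /theta_factor !add0n !mul1n add1n.
Qed.

(** At z = omega the four factors of the denominator are those of omega, omega^2,
    omega^2 and omega; together they are the square of (q^3) / (q). *)
Lemma eval_omega_gf : gf * fps_map (quad_in (-1) (-1)) (sub3 phi) ^+ 2 = Phi ^+ 4.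
Proof.
set D := qpochs [:: zq 1; zq (-1); zq 2; zq (-2)].
have DE : D = qpoch (zq 1) * (qpoch (zq (-1)) * (qpoch (zq 2) * (qpoch (zq (-2)) * 1))).
  by rewrite /D /qpochs !big_cons big_nil.
have D0 : D 0%N = 1.
  have q0 m : (qpoch (zq m) : fps laurent) 0%N = 1.
    by rewrite /zq qpoch_iprod iprod0 fpsBE monoE mul0r subr0.
  by rewrite DE !fps_mul0E !q0 !mul1r.
have DV : D * fps_inv D = 1 by apply/funext; exact: fps_mulV.
have gfE : gf * fps_map eval_omega D = Phi ^+ 2.
  have -> : bicrank_gf = qpoch 'X * qpoch 'X * fps_inv D by [].
  rewrite -rmorphM -mulrA [fps_inv D * D]mulrC DV mulr1 rmorphM /= eval_omega_qpochX.
  by rewrite -expr2.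
have evalD : fps_map eval_omega D * Phi ^+ 2 = fps_map (quad_in (-1) (-1)) (sub3 phi) ^+ 2.
  rewrite -omega_euler DE !rmorphM rmorph1 /= !eval_omega_qpoch.
  have -> : omega_pow 1 = omega by [].
  have -> : omega_pow (-1) = omega2 by [].
  have -> : omega_pow 2 = omega2 by [].
  have -> : omega_pow (-2) = omega by [].
  by ring.
by rewrite -evalD mulrA gfE -exprD.
Qed.

Definition omega_gf : fps int := pr1 gf.

Lemma omega_gf_eq : omega_gf * sub3 phi ^+ 2 = phi ^+ 4.
Proof.
have := congr1 (@pr1 _ _ _) eval_omega_gf; rewrite -!rmorphXn pr1M /= !pr1_map pr2_map.
by rewrite mulr0 mulr0 addr0.
Qed.

(** Equivalently, the residue classes 1 and 2 have equal sums. *)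
Lemma gf_real : pr2 gf = 0.
Proof.
have := congr1 (@pr2 _ _ _) eval_omega_gf; rewrite -!rmorphXn pr2M /= !pr1_map !pr2_map.
rewrite !mulr0 add0r addr0 mulrC => e; apply: (@fps_mulIf _ (sub3 phi ^+ 2)).
  by rewrite expr2 fps_mul0E sub3_phi0.
by rewrite mulr0 -[RHS]e rmorphXn.
Qed.

(** As omega^2 = - 1 - omega, the class of 2 is subtracted from both components. *)
Lemma Mstar_mod_omega_gf n : Mstar_mod 0 3 n - Mstar_mod 1 3 n = omega_gf n.
Proof.
have term m w : w = quad_in (-1) (-1) (bicrank_gf n)@_m * omega_pow m ->
    w.1 = (if (m == 0 %[mod 3%N])%Z then Mstar m n else 0) -
          (if (m == 2 %[mod 3%N])%Z then Mstar m n else 0) /\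
    w.2 = (if (m == 1 %[mod 3%N])%Z then Mstar m n else 0) -
          (if (m == 2 %[mod 3%N])%Z then Mstar m n else 0).
  move=> ->; rewrite omega_powE quadME -/(Mstar m n).
  have m_ge0 : 0 <= (m %% 3)%Z by exact: modz_ge0.
  have m_lt3 : (m %% 3)%Z < 3 by exact: ltz_pmod.
  case: (m %% 3)%Z m_ge0 m_lt3 => // k _; case: k => [|[|[|//]]] _ /=.
  - by split; ring.
  - by split; ring.
  - by split; ring.
have G1 : omega_gf n = Mstar_mod 0 3 n - Mstar_mod 2 3 n.
  rewrite /omega_gf /pr1 fps_mapE /eval_omega /mmap quad_sum1 /Mstar_mod.
  rewrite [X in _ = X - _]big_mkcond [X in _ = _ - X]big_mkcond -sumrB.
  by apply: eq_bigr => m _; case: (term m _ erefl).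
have G2 : 0 = Mstar_mod 1 3 n - Mstar_mod 2 3 n.
  transitivity (pr2 gf n); first by rewrite gf_real.
  rewrite /pr2 fps_mapE /eval_omega /mmap quad_sum2 /Mstar_mod.
  rewrite [X in _ = X - _]big_mkcond [X in _ = _ - X]big_mkcond -sumrB.
  by apply: eq_bigr => m _; case: (term m _ erefl).
by rewrite G1; move: G2; lia.
Qed.

Theorem theorem2p4 (n : nat) (hn : n <> 5%N) :
  ((n = 0 %[mod 3] \/ n = 2 %[mod 3])%N ->
     Mstar_mod 0 3 n > Mstar_mod 1 3 n) /\
  ((n = 1 %[mod 3])%N -> Mstar_mod 0 3 n < Mstar_mod 1 3 n).
Proof.
have Gn r : (n %% 3 = r)%N -> res r omega_gf (n %/ 3)%N = Mstar_mod 0 3 n - Mstar_mod 1 3 n.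
  by move=> nr; rewrite Mstar_mod_omega_gf /res -nr mulnC -divn_eq.
split=> [[n0|n2]|n1].
- by rewrite -subr_gt0 -(Gn 0%N) //; apply: res0_pos omega_gf_eq _.
- rewrite -subr_gt0 -(Gn 2%N) //; apply: (res2_pos omega_gf_eq).
  by apply/eqP => n3; apply: hn; rewrite (divn_eq n 3) n2 n3.
- by rewrite -subr_lt0 -(Gn 1%N) //; apply: res1_neg omega_gf_eq _.
Qed.
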